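(* Let $T>0$, let $c_1,c_2\in\mathbb{R}$ with $c_1>c_2$, and let $0<a_1<a_2$. Put $t^*:=\frac{a_2-a_1}{c_1-c_2}$ and $$\pi_T(a_1,a_2):=\mathbb{P}\left(\sup_{t\in[0,T]}(B(t)-c_1t)>a_1,\ \sup_{t\in[0,T]}(B(t)-c_2t)>a_2\right),$$ where $\{B(t):t\ge 0\}$ is a standard Brownian motion. Suppose that $t^*<T$. Then $$\begin{aligned} \pi_{T}(a_1,a_2)={}&\Psi\left(\frac{a_1+c_1T}{\sqrt{T}}\right)-\Psi_2\left(-\sqrt{\frac{t^*}{T}};\ \frac{a_1+c_1t^*}{\sqrt{t^*}},\ -\frac{a_2+c_2T}{\sqrt{T}}\right)\\ &+e^{-2a_1c_1}\left(\Psi\left(\frac{a_1-c_1T}{\sqrt{T}}\right)-\Psi_2\left(\sqrt{\frac{t^*}{T}};\ \frac{a_1-c_1t^*}{\sqrt{t^*}},\ \frac{(2a_1-a_2)-c_2T}{\sqrt{T}}\right)\right)\\ &+e^{-2a_2c_2}\,\Psi_2\left(\sqrt{\frac{t^*}{T}};\ \frac{a_2-c_2t^*}{\sqrt{t^*}},\ \frac{a_2-c_2T}{\sqrt{T}}\right)\\ &+e^{-2(a_1(c_1-2c_2)+a_2c_2)}\,\Psi_2\left(-\sqrt{\frac{t^*}{T}};\ \frac{(2a_1-a_2)+c_2t^*}{\sqrt{t^*}},\ \frac{(a_2-2a_1)-c_2T}{\sqrt{T}}\right). \end{aligned}$$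
   Context: $\Psi(x)=\mathbb{P}(\mathcal{N}>x)$, where $\mathcal{N}$ is a standard normal random variable. For $\rho\in[-1,1]$ and $s,t\in\mathbb{R}$, $\Psi_2(\rho;s,t)=\mathbb{P}(X>s,\,Y>t)$, where $(X,Y)$ is a bivariate normal vector with mean $(0,0)$ and covariance matrix $\begin{pmatrix}1&\rho\\ \rho&1\end{pmatrix}$. A standard Brownian motion starts at $B(0)=0$. The number $t^*$ is the unique point of intersection of the lines $t\mapsto a_1+c_1t$ and $t\mapsto a_2+c_2t$. *)

(* Defs.v *)
From HB Require Import structures.
From mathcomp Require Import all_boot all_order all_algebra.
From mathcomp Require Import all_classical all_reals all_analysis.
From mathcomp Require Import ring lra.

Set Implicit Arguments.
Unset Strict Implicit.
Unset Printing Implicit Defensive.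

Import Order.TTheory GRing.Theory Num.Theory.
Import numFieldNormedType.Exports.

Local Open Scope classical_set_scope.
Local Open Scope ring_scope.

Definition Psi (R : realType) (x : R) : R :=
  fine (normal_prob (0 : R) 1 [set z | x < z]).

(* Law of A (Z1, Z2)^T for independent standard normal Z1, Z2, that is, the
   bivariate normal law with mean (0, 0) and covariance matrix A *m A^T.
   It is defined as an image law, rather than by a density, so that degenerate
   covariance matrices are covered. *)
Definition bivariate_normal (R : realType) (A : 'M[R]_2) :
    set (R * R) -> \bar R :=
  pushforward (normal_prob (0 : R) 1 \x normal_prob (0 : R) 1)%E
    (fun z : R * R => (A 0 0 * z.1 + A 0 1 * z.2, A 1 0 * z.1 + A 1 1 * z.2)).

Definition corr_mx (R : realType) (rho : R) : 'M[R]_2 :=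
  \matrix_(i, j) (if i == j then 1 else rho).

(* The Cholesky factor ((1, 0), (rho, sqrt (1 - rho^2))) of corr_mx rho. *)
Definition corr_factor (R : realType) (rho : R) : 'M[R]_2 :=
  \matrix_(i, j) (if i == 0 then (if j == 0 then 1 else 0)
                  else (if j == 0 then rho else Num.sqrt (1 - rho ^+ 2))).

Lemma corr_factorK (R : realType) (rho : R) : -1 <= rho <= 1 ->
  corr_factor rho *m (corr_factor rho)^T = corr_mx rho.
Proof.
move=> /andP[rhoN1 rho1].
have rho2 : 0 <= 1 - rho ^+ 2 by nra.
apply/matrixP => i j; rewrite !mxE big_ord_recl big_ord1 !mxE /=.
case: i => [[|[|//]] ?]; case: j => [[|[|//]] ?]; rewrite -!val_eqE /=.
- by ring.
- by ring.
- by ring.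
- by rewrite -!expr2 sqr_sqrtr//; ring.
Qed.

(* Meaningful for -1 <= rho <= 1, by corr_factorK. *)
Definition Psi2 (R : realType) (rho s t : R) : R :=
  fine (bivariate_normal (corr_factor rho) [set p | s < p.1 /\ t < p.2]).

Definition mutually_independent d (Omega : measurableType d) (R : realType)
    (P : probability Omega R) (I : finType) (X : I -> Omega -> R) : Prop :=
  forall (J : {set I}) (A : I -> set R),
    (forall i, measurable (A i)) ->
    P [set w | forall i, i \in J -> A i (X i w)] =
    (\prod_(i in J) P (X i @^-1` A i))%E.

(* Only the times t >= 0 matter. Continuity is required of every path, so that
   events about suprema over time intervals are measurable. The law of the
   increments is compared with the normal law on measurable sets only, since
   measures are junk elsewhere; the second parameter of normal_prob is the
   standard deviation. *)
Record standard_brownian_motion d (Omega : measurableType d) (R : realType)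
    (P : probability Omega R) (B : R -> {RV P >-> R}) : Prop := {
  bm_start : {ae P, forall w, B 0 w = 0} ;
  bm_continuous : forall w, {within `[0, +oo[, continuous (fun t => B t w)} ;
  bm_independent : forall (n : nat) (t : nat -> R), 0 <= t 0%N ->
    (forall i, (i < n)%N -> t i < t i.+1) ->
    mutually_independent P (fun (i : 'I_n) w => B (t i.+1) w - B (t i) w) ;
  bm_normal : forall s t, 0 <= s -> s < t -> forall A : set R, measurable A ->
    P [set w | A (B t w - B s w)] = normal_prob 0 (Num.sqrt (t - s)) A }.

Definition sup_drift d (Omega : measurableType d) (R : realType)
    (P : probability Omega R) (B : R -> {RV P >-> R}) (T c : R)
    (w : Omega) : \bar R :=
  ereal_sup [set (B t w - c * t)%:E | t in `[0, T]].

Definition joint_crossing_prob d (Omega : measurableType d) (R : realType)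
    (P : probability Omega R) (B : R -> {RV P >-> R})
    (T c1 c2 a1 a2 : R) : \bar R :=
  P [set w | (a1%:E < sup_drift B T c1 w)%E /\ (a2%:E < sup_drift B T c2 w)%E].

Arguments standard_brownian_motion {d Omega R} P B.
Arguments joint_crossing_prob {d Omega R} P B T c1 c2 a1 a2.

(* Main.v *)
Require Import Defs.
From HB Require Import structures.
From mathcomp Require Import all_boot all_order all_algebra.
From mathcomp Require Import all_classical all_reals all_analysis.
From mathcomp Require Import measurable_realfun.
From mathcomp Require Import ring lra.

Set Implicit Arguments.
Unset Strict Implicit.
Unset Printing Implicit Defensive.

Import Order.TTheory GRing.Theory Num.Theory.
Import numFieldNormedType.Exports.

Local Open Scope classical_set_scope.
Local Open Scope ring_scope.

(** Let N1 and N2 be the events that the path stays below the first and below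
    the second line up to time T.  The probability to be computed is
    1 - P N1 - P N2 + P (N1 `&` N2).  The lines meet at ts, so staying below
    both means staying below one broken line, with slope c1 before ts and c2
    after; N1 and N2 are of the same kind, with equal slopes on both pieces.
    All three probabilities are therefore given by [prob_stays_below]: apply
    the operators of two kernels [killed], one per piece, to the constant 1.

    The kernel [killed c h y z] is the transition density of the distance
    between the line and the path, killed when it reaches 0: a Gaussian density
    times 1 - exp (- 2yz/h), the probability that a Brownian bridge from y to z
    of duration h avoids 0.  It is reached through discrete time only, without
    stopping times.  Observed on a grid of n steps of length h, the distance is
    a Gaussian walk, and the probability that it stays nonnegative is an
    iteration of the operator of the Gaussian kernel [drifted]
    ([integral_stays], [prob_grid_below]).  This iteration is squeezed:
    - [drifted] dominates [killed], and the kernels [killed] form a semigroup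
      ([killed_semigroup], by the method of images), hence n steps of [drifted]
      dominate [killed] over the whole time n * h;
    - if the motion is killed at level - e instead of 0, then for y, z >= 0 the
      avoidance probability over one step is at least 1 - exp (- 2e^2/h); so
      [drifted] exceeds the kernel killed at - e by at most the inverse of this
      factor, and n such factors tend to 1 when h = u / n, because
      n exp (- 2e^2n/u) tends to 0 ([iter_le_kop_killed_at],
      [cvg_overshoot]).
    The number of steps tends to infinity first, by continuity of the paths for
    the lower bound, and then e tends to 0 by dominated convergence.

    It remains to evaluate the integrals.  Writing [killed] as a difference of
    two Gaussian densities turns the one-piece operator into values of Psi and
    the two-piece operator into four masses of quadrants under a bivariate
    normal law, that is, values of Psi2 ([kop_killed_one], [kop_killed_two]).
    Because the lines meet at ts, two of the four terms of P (N1 `&` N2)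
    cancel with two of those of P N2; the four that are left are the
    four Psi2 of the formula. *)

(** * Gaussian densities and the killed kernel *)

Section heat_kernel.
Context {R : realType}.
Local Notation mu := (@lebesgue_measure R).
Implicit Types h s x y z w c e : R.

(** The second parameter of [normal_pdf] is a standard deviation, while h is an
    elapsed time, that is, a variance. *)
Definition heat h x : R := normal_pdf 0 (Num.sqrt h) x.

Lemma heatE h x : 0 < h ->
  heat h x = (Num.sqrt (h * pi *+ 2))^-1 * expR (- (x ^+ 2 / (h *+ 2))).
Proof.
move=> h0; have sh : Num.sqrt h != 0 by rewrite sqrtr_eq0 -ltNge.
rewrite /heat normal_pdfE// /normal_peak /normal_fun subr0 sqr_sqrtr ?ltW//.
by rewrite mulNr.
Qed.

Lemma heat_ge0 h x : 0 <= heat h x.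
Proof. exact: normal_pdf_ge0. Qed.

Lemma heatN h x : 0 < h -> heat h (- x) = heat h x.
Proof. by move=> h0; rewrite !heatE// sqrrN. Qed.

Lemma heat_center m h z : 0 < h -> normal_pdf m (Num.sqrt h) z = heat h (z - m).
Proof.
move=> h0; have sh : Num.sqrt h != 0 by rewrite sqrtr_eq0 -ltNge.
by rewrite /heat !normal_pdfE// normal_fun_center.
Qed.

Lemma continuous_heat h : 0 < h -> continuous (heat h).
Proof.
by move=> h0; apply: continuous_normal_pdf; rewrite sqrtr_eq0 -ltNge.
Qed.

Lemma measurable_heat h : measurable_fun [set: R] (heat h).
Proof. exact: measurable_normal_pdf. Qed.

Lemma integral_heat h m : 0 < h -> (\int[mu]_z (heat h (z - m))%:E = 1)%E.
Proof.
move=> h0; rewrite -(integral_normal_pdf m (Num.sqrt h)).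
by apply: eq_integral => z _; rewrite heat_center.
Qed.

(** Completing the square in z: what remains beside a Gaussian density in z,
    centred at the weighted mean of y and w, depends on y and w only. *)
Lemma heat_mul h s y z w : 0 < h -> 0 < s ->
  heat h (z - y) * heat s (w - z) =
  heat (h + s) (w - y) * heat (h * s / (h + s)) (z - (y * s + w * h) / (h + s)).
Proof.
move=> h0 s0; have hs0 : 0 < h + s by exact: addr_gt0.
have hhs0 : 0 < h * s / (h + s) by rewrite divr_gt0// mulr_gt0.
have p0 := pi_gt0 R.
rewrite !heatE// mulrACA [RHS]mulrACA -!invfM -?expRD -?sqrtrM; last 2 first.
- by rewrite mulrn_wge0// mulr_ge0// ltW.
- by rewrite mulrn_wge0// mulr_ge0// ltW.
congr (_^-1 * expR _).
- by congr Num.sqrt; field; rewrite gt_eqF.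
- by field; rewrite !gt_eqF.
Qed.

Lemma heat_convolution h s y w : 0 < h -> 0 < s ->
  (\int[mu]_z (heat h (z - y) * heat s (w - z))%:E = (heat (h + s) (w - y))%:E)%E.
Proof.
move=> h0 s0.
under eq_integral do rewrite heat_mul// EFinM.
rewrite ge0_integralZl//=.
- by rewrite integral_heat ?mule1// divr_gt0 ?mulr_gt0// addr_gt0.
- apply/measurable_EFinP; apply: measurableT_comp; first exact: measurable_heat.
  exact: measurable_funB.
- by move=> z _; rewrite lee_fin heat_ge0.
- by rewrite lee_fin heat_ge0.
Qed.

(** Transition density, over a time h, of a Brownian motion with drift c killed
    when it leaves the positive half-line.  The second factor is the probability
    that a Brownian bridge from y to z avoids 0; it does not depend on the
    drift. *)
Definition killed c h y z : R :=
  heat h (z - y - c * h) * (1 - expR (- (2 * y * z / h))).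

(** The exponential is the Girsanov factor of the drift. *)
Lemma heat_drift c h x : 0 < h ->
  heat h (x - c * h) = expR (c * x - c ^+ 2 * h / 2) * heat h x.
Proof.
move=> h0; rewrite !heatE// mulrCA; congr (_ * _); rewrite -expRD; congr expR.
by field; rewrite gt_eqF.
Qed.

Lemma heat_reflect h y z : 0 < h ->
  heat h (z + y) = heat h (z - y) * expR (- (2 * y * z / h)).
Proof.
move=> h0; rewrite !heatE// -[RHS]mulrA; congr (_ * _); rewrite -expRD; congr expR.
by field; rewrite gt_eqF.
Qed.

(** Method of images: up to the Girsanov factor, killing at 0 amounts to
    subtracting the density of the motion started at - y, which makes the
    density odd in z. *)
Lemma killedE c h y z : 0 < h ->
  killed c h y z =
  expR (c * (z - y) - c ^+ 2 * h / 2) * (heat h (z - y) - heat h (z + y)).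
Proof. by move=> h0; rewrite /killed heat_drift// (heat_reflect y z)//; ring. Qed.

Lemma killed_ge0 c h y z : 0 < h -> 0 <= y -> 0 <= z -> 0 <= killed c h y z.
Proof.
move=> h0 y0 z0; rewrite mulr_ge0 ?heat_ge0// subr_ge0 -expR0 ler_expR oppr_le0.
by rewrite divr_ge0 ?mulr_ge0// ltW.
Qed.

Lemma killed_le c h y z : killed c h y z <= heat h (z - y - c * h).
Proof. by rewrite ler_piMr ?heat_ge0// lerBlDr lerDl expR_ge0.
Qed.

Lemma measurable_heat_comp d (T : measurableType d) h (f : T -> R) :
  measurable_fun setT f -> measurable_fun setT (fun t => heat h (f t)).
Proof. by move=> mf; apply: measurableT_comp => //; exact: measurable_heat. Qed.

Lemma measurable_killed c h :
  measurable_fun [set: R * R] (fun p => killed c h p.1 p.2).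
Proof.
apply: measurable_funM.
  apply: measurable_heat_comp; apply: measurable_funB => //.
  exact: measurable_funB.
apply: measurable_funB => //; apply: measurableT_comp => //.
apply: measurableT_comp => //; apply: measurable_funM => //.
by apply: measurable_funM => //; exact: measurable_funM.
Qed.

Lemma integrable_heat_mul h s y w : 0 < h -> 0 < s ->
  mu.-integrable setT (fun z => (heat h (z - y) * heat s (w - z))%:E).
Proof.
move=> h0 s0; apply/integrableP; split.
  by apply/measurable_EFinP/measurable_funM; apply: measurable_heat_comp;
    exact: measurable_funB.
under eq_integral do rewrite gee0_abs ?lee_fin ?mulr_ge0 ?heat_ge0//.
by rewrite heat_convolution// ltry.
Qed.

(** The integrand is even in z, so its integral is half of the one over the whole
    line, where both summands integrate to the same Gaussian density. *)
Lemma half_heat_convolution h s y w : 0 < h -> 0 < s ->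
  (\int[mu]_(z in `[0%R, +oo[)
     (heat h (z - y) * heat s (w - z) + heat h (z + y) * heat s (w + z))%:E
   = (heat (h + s) (w - y))%:E)%E.
Proof.
move=> h0 s0.
set F := fun z => heat h (z - y) * heat s (w - z)
  + heat h (z + y) * heat s (w + z).
have F0 z : 0 <= F z by rewrite addr_ge0 ?mulr_ge0 ?heat_ge0.
have cF : continuous F.
  move=> z; have ch := continuous_heat h0; have cs := continuous_heat s0.
  apply: cvgD; apply: cvgM.
  - apply: (cvg_comp (fun z => z - y) (heat h)); last exact: ch.
    by apply: (@cvgB _ R^o); [exact: cvg_id|exact: cvg_cst].
  - apply: (cvg_comp (fun z => w - z) (heat s)); last exact: cs.
    by apply: (@cvgB _ R^o); [exact: cvg_cst|exact: cvg_id].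
  - apply: (cvg_comp (fun z => z + y) (heat h)); last exact: ch.
    by apply: (@cvgD _ R^o); [exact: cvg_id|exact: cvg_cst].
  - apply: (cvg_comp (fun z => w + z) (heat s)); last exact: cs.
    by apply: (@cvgD _ R^o); [exact: cvg_cst|exact: cvg_id].
have Fsym : F =1 F \o -%R.
  move=> z; rewrite /F /= opprK addrC; congr (_ * _ + _ * _).
  - by rewrite -heatN//; congr heat; ring.
  - by rewrite -heatN//; congr heat; ring.
have /= := ge0_symfun_integralT F0 cF Fsym.
rewrite -set_itvcy => HF.
have : (\int[mu]_z (F z)%:E = 2%:E * (heat (h + s) (w - y))%:E)%E.
  under eq_integral do rewrite /F EFinD.
  rewrite ge0_integralD//=.
  - rewrite heat_convolution//.
    have -> : (\int[mu]_z (heat h (z + y) * heat s (w + z))%:E =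
        (heat (h + s) (w - y))%:E)%E.
      have -> : w - y = - ((- w) - (- y)) by ring.
      rewrite heatN ?addr_gt0// -(heat_convolution (- y) (- w) h0 s0).
      apply: eq_integral => z _; rewrite opprK -(heatN (w + z) s0).
      by congr ((_ * heat _ _)%:E); ring.
    by rewrite mule_natl mule2n.
  - by move=> z _; rewrite lee_fin mulr_ge0 ?heat_ge0.
  - by apply/measurable_EFinP/measurable_funM; apply: measurable_heat_comp;
      exact: measurable_funB.
  - by move=> z _; rewrite lee_fin mulr_ge0 ?heat_ge0.
  - by apply/measurable_EFinP/measurable_funM; apply: measurable_heat_comp;
      exact: measurable_funD.
by rewrite HF => /eqP; rewrite eq_le !lee_pmul2l// -eq_le => /eqP.
Qed.

(** Chapman-Kolmogorov equation.  The Girsanov factors multiply, and the product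
    of the two differences of images is even in z: it is the difference of the
    integrands of [half_heat_convolution] for w and for - w. *)
Lemma killed_semigroup c h s y w : 0 < h -> 0 < s ->
  (\int[mu]_(z in `[0%R, +oo[) (killed c h y z * killed c s z w)%:E =
   (killed c (h + s) y w)%:E)%E.
Proof.
move=> h0 s0.
pose K := expR (c * (w - y) - c ^+ 2 * (h + s) / 2).
pose F v z := heat h (z - y) * heat s (v - z) + heat h (z + y) * heat s (v + z).
have iF v : mu.-integrable `[0%R, +oo[ (fun z => (F v z)%:E).
  apply: (integrableS measurableT) => //.
  under eq_fun do rewrite /F EFinD.
  apply: integrableD => //; first exact: integrable_heat_mul.
  have := integrable_heat_mul (- y) (- v) h0 s0.
  apply: eq_integrable => // z _.
  by rewrite opprK -(heatN (v + z) s0); congr ((_ * heat _ _)%:E); ring.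
have E z : killed c h y z * killed c s z w = K * (F w z - F (- w) z).
  rewrite !killedE// /F /K.
  have -> : c * (w - y) - c ^+ 2 * (h + s) / 2 =
    (c * (z - y) - c ^+ 2 * h / 2) + (c * (w - z) - c ^+ 2 * s / 2) by field.
  have e1 : heat s (- w - z) = heat s (w + z) by rewrite -opprD heatN.
  have e2 : heat s (- w + z) = heat s (w - z) by rewrite -heatN// opprD opprK.
  by rewrite [in RHS]expRD e1 e2; ring.
under eq_integral do rewrite E EFinM.
have iFF : mu.-integrable `[0%R, +oo[ (fun z => (F w z - F (- w) z)%:E).
  by exact: (integrableB _ (iF w) (iF (- w))).
rewrite integralZl//=.
rewrite integralB_EFin//=; [|exact: iF|exact: iF].
rewrite !half_heat_convolution// -EFinB -EFinM.
rewrite killedE ?addr_gt0//; congr ((_ * (_ - _))%:E).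
by rewrite -heatN ?addr_gt0// opprD !opprK.
Qed.

End heat_kernel.

(** * Integral operators on the half-line *)

Section affine.
Context {R : realType}.
Local Notation mu := (@lebesgue_measure R).
Local Open Scope ereal_scope.

(* The ascription makes the function live on the Borel sigma-algebra on which
   the Lebesgue measure is defined. *)
Let affine (a b : R) : measurableTypeR R -> measurableTypeR R :=
  fun x => (a * x + b)%R.

Let measurable_affine a b : measurable_fun setT (affine a b).
Proof. by apply: measurable_funD => //; exact: measurable_funM. Qed.

Let affine_measure (a : {nonneg R}) (b : R) : {measure set (measurableTypeR R) -> \bar R}.
Proof.
unshelve refine (mscale a (pushforward mu (affine a%:num b)) :
  {measure set (measurableTypeR R) -> \bar R}).
exact: measurable_affine.
Defined.

Let lebesgue_measure_affine (a b : R) (a0 : (0 < a)%R) (A : set R) :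
  measurable A -> mu A = affine_measure (NngNum (ltW a0)) b A.
Proof.
move=> mA; apply: (@lebesgue_measure_unique _ (affine_measure _ _)) => //.
move=> _ [[u v]] _ <-; rewrite /affine_measure/= /mscale/= /pushforward.
rewrite (_ : _ @^-1` _ = `]((u - b) / a)%R, ((v - b) / a)%R]%classic); last first.
  apply/seteqP; split => x /=; rewrite !in_itv/= ltr_pdivrMr// ler_pdivlMr//;
  by rewrite ltrBlDr lerBrDr (mulrC x).
rewrite !lebesgue_measure_itv/= !lte_fin ltr_pM2r ?invr_gt0// ltrD2r.
case: ifPn => _; last by rewrite mule0.
by rewrite -!EFinD -EFinM; congr EFin; field; rewrite gt_eqF.
Qed.

Lemma ge0_integral_affine (a b : R) (f : R -> \bar R) : (0 < a)%R ->
  measurable_fun setT f -> (forall x, 0 <= f x) ->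
  a%:E * \int[mu]_x f (a * x + b)%R = \int[mu]_x f x.
Proof.
move=> a0 mf f0.
rewrite [RHS](@eq_measure_integral _ _ _ setT
  (affine_measure (NngNum (ltW a0)) b)); last first.
  by move=> A mA _; rewrite -lebesgue_measure_affine.
rewrite /affine_measure/= ge0_integral_mscale//= ge0_integral_pushforward//.
Qed.

Lemma ge0_integral_subl (b : R) (f : R -> \bar R) :
  measurable_fun setT f -> (forall x, 0 <= f x) ->
  \int[mu]_x f (b - x)%R = \int[mu]_x f x.
Proof.
move=> mf f0.
have mN : measurable_fun setT (-%R : measurableTypeR R -> measurableTypeR R).
  by apply: (continuous_measurable_fun (f := -%R)); exact: opp_continuous.
transitivity (\int[mu]_x f (b + x)%R).
  rewrite [RHS](@eq_measure_integral _ _ _ setT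
     (pushforward mu (-%R : measurableTypeR R -> measurableTypeR R))); last first.
    by move=> A mA _; apply: esym; exact: lebesgue_measureN.
  rewrite ge0_integral_pushforward//.
  by apply: measurableT_comp => //; exact: measurable_funD.
rewrite -(@ge0_integral_affine 1 b f)// mul1e; apply: eq_integral => x _.
by rewrite mul1r addrC.
Qed.

End affine.

Section kernel_operator.
Context {R : realType}.
Local Notation mu := (@lebesgue_measure R).
Local Notation D := (`[0%R, +oo[%classic : set R).
Local Open Scope ereal_scope.
Implicit Types (k : R -> R -> R) (f g : R -> \bar R).

Definition kop k f (y : R) : \bar R := \int[mu]_(z in D) ((k y z)%:E * f z).

(** Signs are prescribed on the half-line only, because [killed c h y z] is
    negative when y and z have opposite signs. *)
Definition ge0_kernel k :=
  measurable_fun setT (fun p : R * R => k p.1 p.2) /\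
  (forall y z, (0 <= y)%R -> (0 <= z)%R -> (0 <= k y z)%R).

Definition ge0_fun f := measurable_fun D f /\ (forall z, (0 <= z)%R -> 0 <= f z).

Let inD (x : R) : D x = (0 <= x)%R :> Prop.
Proof. by rewrite /= in_itv/= andbT. Qed.

Lemma ge0_kernel_fun k y : ge0_kernel k -> (0 <= y)%R -> ge0_fun (EFin \o k y).
Proof.
move=> [mk k0] y0; split; last by move=> z z0; rewrite lee_fin k0.
apply/measurable_EFinP; apply: measurable_funTS.
exact: (measurable_fun_pair2 y mk).
Qed.

Lemma ge0_funM f g : ge0_fun f -> ge0_fun g -> ge0_fun (f \* g).
Proof.
move=> [mf f0] [mg g0]; split; last by move=> z z0; rewrite mule_ge0 ?f0 ?g0.
exact: emeasurable_funM.
Qed.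

Lemma le_kop k1 k2 f g y : ge0_kernel k1 -> ge0_kernel k2 -> ge0_fun f ->
  ge0_fun g -> (0 <= y)%R ->
  (forall z, (0 <= z)%R -> (k1 y z <= k2 y z)%R) ->
  (forall z, (0 <= z)%R -> f z <= g z) -> kop k1 f y <= kop k2 g y.
Proof.
move=> k1P k2P fP gP y0 k12 fg.
have [m1 p1] := ge0_funM (ge0_kernel_fun k1P y0) fP.
have [m2 p2] := ge0_funM (ge0_kernel_fun k2P y0) gP.
apply: ge0_le_integral => //.
- by move=> z; rewrite inD; exact: p1.
- move=> z; rewrite inD => z0; rewrite lee_pmul//.
  + by rewrite lee_fin k1P.2.
  + exact: fP.2.
  + by rewrite lee_fin k12.
  + exact: fg.
Qed.

Let restrD (F : R * R -> \bar R) (y z : R) :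
  (F \_ (D `*` D)) (y, z) = ((fun y => (fun z => F (y, z)) \_ D) \_ D) y z.
Proof.
rewrite !patchE in_setX/= ; case: (y \in D) => //=; by rewrite patchE.
Qed.

Lemma measurable_kop k f : ge0_kernel k -> ge0_fun f -> ge0_fun (kop k f).
Proof.
move=> [mk k0] [mf f0]; split; last first.
  move=> y y0; apply: integral_ge0 => z; rewrite inD => z0.
  by rewrite mule_ge0 ?f0// lee_fin k0.
pose F (p : R * R) := (k p.1 p.2)%:E * f p.2.
have mF : measurable_fun setT (F \_ (D `*` D)).
  apply/(measurable_restrictT _ _).1; first exact: measurableX.
  apply: emeasurable_funM.
    by apply/measurable_EFinP; exact: measurable_funTS.
  apply: (@measurable_comp _ _ _ _ _ _ D f _ snd).
  - exact: measurable_itv.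
  - by move=> _ [[a b] /= [_ Db] <-].
  - exact: mf.
  - exact: measurable_funTS.
have F0 p : 0 <= (F \_ (D `*` D)) p.
  rewrite patchE; case: ifPn => // /[!inE] -[]; rewrite !inD => y0 z0.
  by rewrite /F mule_ge0 ?f0// lee_fin k0.
have := measurable_fun_fubini_tonelli_F (m2 := mu) _ mF F0.
move/(measurable_funTS (D := D)); apply: eq_measurable_fun => y Dy.
rewrite /fubini_F /kop [RHS]integral_mkcond; apply: eq_integral => z _.
by rewrite restrD patchE Dy.
Qed.

(** Tonelli's theorem, applied to the integrand set to 0 outside the quadrant, as
    it is nonnegative there only. *)
Lemma kop_comp k1 k2 f y : ge0_kernel k1 -> ge0_kernel k2 -> ge0_fun f ->
  (0 <= y)%R ->
  kop k1 (kop k2 f) y =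
  \int[mu]_(w in D) ((\int[mu]_(z in D) (k1 y z * k2 z w)%:E) * f w).
Proof.
move=> [mk1 k10] [mk2 k20] [mf f0] y0.
pose F (p : R * R) := (k1 y p.1 * k2 p.1 p.2)%:E * f p.2.
have mk : measurable_fun setT (fun p : R * R => (k1 y p.1 * k2 p.1 p.2)%:E).
  apply/measurable_EFinP; apply: measurable_funM => //.
  exact: (measurableT_comp (measurable_fun_pair2 y mk1)).
have mF : measurable_fun setT (F \_ (D `*` D)).
  apply/(measurable_restrictT _ _).1; first exact: measurableX.
  apply: emeasurable_funM; first exact: measurable_funTS.
  apply: (@measurable_comp _ _ _ _ _ _ D f _ snd).
  - exact: measurable_itv.
  - by move=> _ [[a b] /= [_ Db] <-].
  - exact: mf.
  - exact: measurable_funTS.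
have F0 p : 0 <= (F \_ (D `*` D)) p.
  rewrite patchE; case: ifPn => // /[!inE] -[]; rewrite !inD => a0 b0.
  by rewrite /F mule_ge0 ?f0// lee_fin mulr_ge0 ?k10 ?k20.
have k2f z w : D z -> D w -> 0 <= (k2 z w)%:E * f w.
  by rewrite !inD => z0 w0; rewrite mule_ge0 ?f0// lee_fin k20.
transitivity (\int[mu]_z \int[mu]_w (F \_ (D `*` D)) (z, w)).
  rewrite /kop integral_mkcond; apply: eq_integral => z _.
  rewrite patchE; case: ifPn => [zD|zD]; last first.
    by rewrite integral0_eq// => w _; rewrite restrD patchE (negbTE zD).
  rewrite -ge0_integralZl//=.
  - rewrite [LHS]integral_mkcond; apply: eq_integral => w _.
    rewrite restrD !patchE zD patchE; case: ifPn => // _.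
    by rewrite /F/= EFinM muleA.
  - apply: emeasurable_funM => //; apply/measurable_EFinP.
    exact: measurable_funTS (measurable_fun_pair2 z mk2).
  - by move=> w Dw; apply: k2f => //; exact/set_mem.
  - by rewrite lee_fin k10//; move/set_mem : zD; rewrite inD.
rewrite fubini_tonelli//.
rewrite [RHS]integral_mkcond; apply: eq_integral => w _.
rewrite patchE; case: ifPn => [wD|wD]; last first.
  rewrite integral0_eq// => z _; rewrite restrD patchE.
  by case: ifPn => // _; rewrite patchE (negbTE wD).
have wD' : (0 <= w)%R by move/set_mem: wD; rewrite inD.
rewrite -ge0_integralZr//=.
- rewrite [RHS]integral_mkcond; apply: eq_integral => z _.
  rewrite restrD !patchE; case: ifPn => // _.
  by rewrite patchE wD.
- exact: measurable_funTS (measurable_fun_pair1 w mk).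
- by move=> z; rewrite in_itv/= andbT => z0; rewrite lee_fin mulr_ge0 ?k10 ?k20.
- exact: f0.
Qed.

Lemma kopZl k f y (C : R) : (0 <= C)%R -> ge0_kernel k -> ge0_fun f ->
  (0 <= y)%R -> kop k (fun z => C%:E * f z) y = C%:E * kop k f y.
Proof.
move=> C0 kP fP y0; have [m p] := ge0_funM (ge0_kernel_fun kP y0) fP.
rewrite -ge0_integralZl//=.
  by apply: eq_integral => z _; rewrite muleCA.
by move=> z; rewrite in_itv/= andbT; exact: p.
Qed.

End kernel_operator.

(** * Comparison of the discrete and the killed motion *)

Section discrete_killing.
Context {R : realType}.
Local Notation mu := (@lebesgue_measure R).
Local Notation D := (`[0%R, +oo[%classic : set R).
Implicit Types (c h s y z w e : R) (f g : R -> \bar R).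

Definition drifted c h y z : R := heat h (z - y - c * h).

(** The motion is killed at level - e instead of 0. *)
Definition killed_at e c h y z : R := killed c h (y + e) (z + e).

Lemma ge0_kernel_drifted c h : ge0_kernel (drifted c h).
Proof.
split; last by move=> *; exact: heat_ge0.
by apply: measurable_heat_comp; apply: measurable_funB => //; exact: measurable_funB.
Qed.

Lemma ge0_kernel_killed c h : 0 < h -> ge0_kernel (killed c h).
Proof.
by move=> h0; split; [exact: measurable_killed|move=> *; exact: killed_ge0].
Qed.

Lemma ge0_kernel_killed_at e c h : 0 <= e -> 0 < h -> ge0_kernel (killed_at e c h).
Proof.
move=> e0 h0; split; last by move=> *; rewrite killed_ge0// addr_ge0.
have m1 : measurable_fun setT (fun p : R * R => p.1 + e) by exact: measurable_funD.
have m2 : measurable_fun setT (fun p : R * R => p.2 + e) by exact: measurable_funD.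
exact: (measurableT_comp (measurable_killed c h) (measurable_fun_pair m1 m2)).
Qed.

Lemma ge0_integral_shift_le e g : 0 <= e -> ge0_fun g ->
  (\int[mu]_(z in D) g (z + e)%R <= \int[mu]_(z in D) g z)%E.
Proof.
move=> e0 [mg g0].
have mgD : measurable_fun setT (g \_ D) by apply/(measurable_restrictT _ _).1.
have gD0 x : (0 <= (g \_ D) x)%E.
  by rewrite patchE; case: ifPn => // /[!inE]/=; rewrite in_itv/= andbT => /g0.
rewrite [leRHS]integral_mkcond -(@ge0_integral_affine _ 1 e (g \_ D))// mul1e.
rewrite [leLHS]integral_mkcond; apply: ge0_le_integral => //.
- move=> x _; rewrite patchE; case: ifPn => // /[!inE]/=.
  by rewrite in_itv/= andbT => x0; rewrite g0// addr_ge0.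
- apply/(measurable_restrictT _ _).1 => //.
  apply: (@measurable_comp _ _ _ _ _ _ D g _ (fun z => z + e)).
  + exact: measurable_itv.
  + move=> _ [x /= + <-]; rewrite !in_itv/= !andbT => x0; exact: addr_ge0.
  + exact: mg.
  + exact: measurable_funD.
- have m1 : measurable_fun setT (fun x : R => 1 * x + e).
    by under eq_fun do rewrite mul1r; exact: measurable_funD.
  exact: (measurableT_comp mgD m1).
- move=> x _; rewrite mul1r [leLHS]patchE; case: ifPn => // /[!inE]/=.
  rewrite in_itv/= andbT => x0; rewrite patchE mem_set//=.
  by rewrite in_itv/= andbT addr_ge0.
Qed.

Lemma kop_killed_comp c h s f y : 0 < h -> 0 < s -> ge0_fun f -> 0 <= y ->
  kop (killed c h) (kop (killed c s) f) y = kop (killed c (h + s)) f y.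
Proof.
move=> h0 s0 fP y0.
have kP t : 0 < t -> ge0_kernel (killed c t).
  exact: ge0_kernel_killed.
rewrite kop_comp//; [|exact: kP|exact: kP].
by apply: eq_integral => w _; rewrite killed_semigroup.
Qed.

(** There is no equality here, in contrast with [kop_killed_comp]: the
    intermediate position is integrated over z >= 0, while a motion killed at
    - e may also visit the levels between - e and 0. *)
Lemma kop_killed_at_comp_le e c h s f y : 0 <= e -> 0 < h -> 0 < s -> ge0_fun f ->
  0 <= y ->
  (kop (killed_at e c h) (kop (killed_at e c s) f) y <=
   kop (killed_at e c (h + s)) f y)%E.
Proof.
move=> e0 h0 s0 fP y0.
have kP t : 0 < t -> ge0_kernel (killed_at e c t) by exact: ge0_kernel_killed_at.
have k0P t : 0 < t -> ge0_kernel (killed c t).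
  exact: ge0_kernel_killed.
rewrite kop_comp//; [|exact: kP|exact: kP].
have K1 w : 0 <= w ->
    (\int[mu]_(z in D) (killed_at e c h y z * killed_at e c s z w)%:E <=
     (killed_at e c (h + s) y w)%:E)%E.
  move=> w0; rewrite /killed_at -(killed_semigroup c (y + e) (w + e) h0 s0).
  apply: (@ge0_integral_shift_le e (fun z =>
    (killed c h (y + e) z * killed c s z (w + e))%:E)) => //; split.
    apply/measurable_EFinP; apply: measurable_funTS; apply: measurable_funM.
      exact: (measurable_fun_pair2 (y + e) (k0P h h0).1).
    exact: (measurable_fun_pair1 (w + e) (k0P s s0).1).
  by move=> z z0; rewrite lee_fin mulr_ge0 ?killed_ge0// addr_ge0.
have mK : measurable_fun D (fun w =>
    \int[mu]_(z in D) (killed_at e c h y z * killed_at e c s z w)%:E)%E.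
  have kP' : ge0_kernel (fun w z => killed_at e c h y z * killed_at e c s z w).
    split; last by move=> w z w0 z0; rewrite mulr_ge0// (kP _ _).2.
    apply: measurable_funM => /=.
      exact: (measurableT_comp (measurable_fun_pair2 y (kP h h0).1)).
    apply: (measurableT_comp (kP s s0).1 (measurable_fun_pair
      (f := snd) (g := fst) _ _)) => //.
  have f1P : ge0_fun (cst 1%E : R -> \bar R) by split.
  have [+ _] := measurable_kop kP' f1P.
  apply: eq_measurable_fun => w _.
  by apply: eq_integral => z _; rewrite mule1.
apply: ge0_le_integral => //=.
- move=> w; rewrite in_itv/= andbT => w0; rewrite mule_ge0 ?fP.2//.
  apply: integral_ge0 => z /=; rewrite in_itv/= andbT => z0.
  by rewrite lee_fin mulr_ge0// (kP _ _).2.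
- by apply: emeasurable_funM => //; exact: fP.1.
- exact: (ge0_funM (ge0_kernel_fun (kP _ (addr_gt0 h0 s0)) y0) fP).1.
- move=> w; rewrite in_itv/= andbT => w0.
  by apply: lee_wpmul2r; [exact: fP.2|exact: K1].
Qed.

Lemma ge0_fun_iter k f n : ge0_kernel k -> ge0_fun f -> ge0_fun (iter n (kop k) f).
Proof. by move=> kP fP; elim: n => // n ih /=; exact: measurable_kop. Qed.

(** Ignoring the killing inside a step increases the kernel, and n.+1 killed steps
    make one killed step of length n.+1 * h. *)
Lemma kop_killed_le_iter c h f n y : 0 < h -> ge0_fun f -> 0 <= y ->
  (kop (killed c (n.+1%:R * h)) f y <= iter n.+1 (kop (drifted c h)) f y)%E.
Proof.
move=> h0 fP.
have kP t : 0 < t -> ge0_kernel (killed c t).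
  exact: ge0_kernel_killed.
have fk := ge0_kernel_drifted c h.
elim: n y => [|n ih] y y0.
  rewrite mul1r/=; apply: le_kop => //; first exact: kP.
  by move=> z _; exact: killed_le.
have nh0 : 0 < n.+1%:R * h by rewrite mulr_gt0.
have -> : n.+2%:R * h = h + n.+1%:R * h by rewrite -addn1 natrD; ring.
rewrite -(kop_killed_comp c h0 nh0 fP y0) iterS; apply: le_kop => //.
- exact: kP.
- by apply: measurable_kop => //; exact: kP.
- exact: ge0_fun_iter.
- by move=> z _; exact: killed_le.
Qed.

(** Inverse of the probability that a Brownian bridge of duration h from 0 to 0
    stays above - e. *)
Definition overshoot e h : R := (1 - expR (- (2 * e ^+ 2 / h)))^-1.

Lemma overshoot_ge0 e h : 0 < h -> 0 <= overshoot e h.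
Proof.
move=> h0; rewrite invr_ge0 subr_ge0 -expR0 ler_expR oppr_le0.
by apply: divr_ge0; [rewrite mulr_ge0 ?sqr_ge0|exact: ltW].
Qed.

(** Among nonnegative end points y and z, the probability that a bridge avoids
    the level - e is smallest when y = z = 0. *)
Lemma drifted_le_killed_at e c h y z : 0 < e -> 0 < h -> 0 <= y -> 0 <= z ->
  drifted c h y z <= overshoot e h * killed_at e c h y z.
Proof.
move=> e0 h0 y0 z0; rewrite /killed_at /killed /drifted.
have -> : z + e - (y + e) - c * h = z - y - c * h by ring.
rewrite mulrCA ler_peMr ?heat_ge0// /overshoot mulrC.
have d0 : 0 < 1 - expR (- (2 * e ^+ 2 / h)).
  by rewrite subr_gt0 -expR0 ltr_expR oppr_lt0 divr_gt0// mulr_gt0// exprn_gt0.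
rewrite ler_pdivlMr// mul1r lerB// ler_expR lerN2 ler_pM2r ?invr_gt0//.
nra.
Qed.

(** Each step costs a factor [overshoot e h] and replaces the Gaussian kernel by
    the kernel killed at - e, for which steps can be merged. *)
Lemma iter_le_kop_killed_at e c h f n y : 0 < e -> 0 < h -> ge0_fun f -> 0 <= y ->
  (iter n.+1 (kop (drifted c h)) f y <=
   (overshoot e h ^+ n.+1)%:E * kop (killed_at e c (n.+1%:R * h)) f y)%E.
Proof.
move=> e0 h0 fP.
have kP t : 0 < t -> ge0_kernel (killed_at e c t).
  by apply: ge0_kernel_killed_at; exact: ltW.
have C0 := overshoot_ge0 e h0.
have fk := ge0_kernel_drifted c h.
have CkP : ge0_kernel (fun y z => overshoot e h * killed_at e c h y z).
  split; last by move=> *; rewrite mulr_ge0// (kP _ _).2.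
  by apply: measurable_funM => //; exact: (kP _ _).1.
have stepP g x : ge0_fun g -> 0 <= x ->
    (kop (drifted c h) g x <= (overshoot e h)%:E * kop (killed_at e c h) g x)%E.
  move=> gP x0; rewrite -kopZl//; last exact: kP.
  apply: (@le_trans _ _ (kop (fun y z => overshoot e h * killed_at e c h y z) g x)).
    by apply: le_kop => // z z0; exact: drifted_le_killed_at.
  rewrite le_eqVlt; apply/orP; left; apply/eqP; apply: eq_integral => z _.
  by rewrite EFinM muleA (muleC (overshoot e h)%:E).
elim: n y => [|n ih] y y0; first by rewrite mul1r/= expr1; exact: stepP.
have nh0 : 0 < n.+1%:R * h by rewrite mulr_gt0.
have gP := ge0_fun_iter n.+1 fk fP.
have -> : n.+2%:R * h = h + n.+1%:R * h by rewrite -addn1 natrD; ring.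
rewrite iterS; apply: (le_trans (stepP _ _ gP y0)).
rewrite exprS EFinM -muleA; apply: lee_wpmul2l; first by rewrite lee_fin.
have kfP := measurable_kop (kP _ nh0) fP.
apply: (@le_trans _ _ (kop (killed_at e c h) (fun z => (overshoot e h ^+ n.+1)%:E *
    kop (killed_at e c (n.+1%:R * h)) f z) y)%E).
  apply: le_kop => //; [exact: kP|exact: kP|].
  split; last by move=> z z0; rewrite mule_ge0 ?kfP.2// lee_fin exprn_ge0.
  by apply: emeasurable_funM => //; exact: kfP.1.
rewrite kopZl ?exprn_ge0//; last exact: kP.
apply: lee_wpmul2l; first by rewrite lee_fin exprn_ge0.
by apply: kop_killed_at_comp_le => //; exact: ltW.
Qed.

End discrete_killing.

(** * Densities, image laws and independence *)

Section density.
Local Open Scope ereal_scope.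
Context d (T : measurableType d) (R : realType).
Variables (mu nu : {measure set T -> \bar R}) (p : T -> R).
Hypothesis mp : measurable_fun setT p.
Hypothesis p0 : forall x, (0 <= p x)%R.
Hypothesis nuE : forall A, measurable A -> nu A = \int[mu]_(x in A) (p x)%:E.

Import HBNNSimple.

Let mpE : measurable_fun setT (EFin \o p).
Proof. exact/measurable_EFinP. Qed.

Let nnsfun_density (f : {nnsfun T >-> R}) :
  \int[nu]_x (f x)%:E = \int[mu]_x ((f x)%:E * (p x)%:E).
Proof.
under [LHS]eq_integral do rewrite fimfunE -fsumEFin//.
rewrite [LHS]ge0_integral_fsum//; last 2 first.
  - by move=> r; exact/measurable_EFinP/measurableT_comp.
  - by move=> n x _; rewrite EFinM nnfun_muleindic_ge0.
under [RHS]eq_integral.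
  move=> x xD; rewrite fimfunE -fsumEFin// ge0_mule_fsuml; last first.
    by move=> r; rewrite EFinM nnfun_muleindic_ge0.
  over.
rewrite [RHS]ge0_integral_fsum//; last 2 first.
  - move=> r; apply: emeasurable_funM => //.
    by apply/measurable_EFinP; exact: measurableT_comp.
  - move=> n x _; rewrite EFinM; apply: mule_ge0; last by rewrite lee_fin.
    exact: nnfun_muleindic_ge0.
apply: eq_fsbigr => r rf; rewrite integralZl_indic_nnsfun//=.
rewrite integral_indic//= setIT nuE//.
have r0 : (0 <= r)%R by move: rf; rewrite inE => -[t _ <-].
rewrite integral_mkcond -ge0_integralZl//=.
- apply: eq_integral => x _; rewrite patchE EFinM -muleA; congr (_ * _).
  by rewrite indicE; case: ifPn => _; rewrite ?mul1e ?mul0e.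
- by apply/(measurable_restrictT _ _).1 => //; exact: measurable_funTS.
- by move=> x _; rewrite patchE; case: ifPn => // _; rewrite lee_fin.
Qed.

Lemma ge0_integral_density (f : T -> \bar R) : measurable_fun setT f ->
  (forall x, 0 <= f x) -> \int[nu]_x f x = \int[mu]_x (f x * (p x)%:E).
Proof.
move=> mf f0; pose f_ := nnsfun_approx measurableT mf.
transitivity (lim (\int[nu]_x (f_ n x)%:E @[n --> \oo])).
  rewrite -monotone_convergence//=.
  - apply: eq_integral => ? /[!inE] xD; apply/esym/cvg_lim => //=.
    exact: cvg_nnsfun_approx.
  - by move=> n; exact/measurable_EFinP/measurable_funTS.
  - by move=> n ? _; rewrite lee_fin.
  - by move=> ? _ ? ? mn; rewrite lee_fin; exact/lefP/nd_nnsfun_approx.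
rewrite [RHS](_ : _ = lim
    (\int[mu]_x ((f_ n x)%:E * (p x)%:E) @[n --> \oo])); last first.
  rewrite -monotone_convergence//=.
  - apply: eq_integral => x /[!inE] xD; apply/esym/cvg_lim => //.
    by apply: cvgeZr => //; exact: cvg_nnsfun_approx.
  - by move=> n; apply: emeasurable_funM => //; exact/measurable_EFinP.
  - by move=> n ? _; rewrite mule_ge0 ?lee_fin.
  - move=> x _ a b ab; rewrite lee_wpmul2r ?lee_fin//.
    exact/lefP/nd_nnsfun_approx.
by apply: congr_lim; apply/funext => n /=; exact: nnsfun_density.
Qed.

End density.

Section pushforward_finite.
Local Open Scope ereal_scope.
Context d d' (T : measurableType d) (T' : measurableType d') (R : realType).
Variables (m : {finite_measure set T -> \bar R}) (f : T -> T').
Hypothesis mf : measurable_fun setT f.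

(** The image measure, with the measurability of f as an argument so that the
    finiteness of the measure can be found by inference. *)
Definition law of measurable_fun setT f : set T' -> \bar R := pushforward m f.

Let law0 : law mf set0 = 0.
Proof. by rewrite /law /pushforward preimage_set0 measure0. Qed.

Let law_ge0 A : 0 <= law mf A.
Proof. exact: measure_ge0. Qed.

Let law_sigma_additive : semi_sigma_additive (law mf).
Proof.
move=> F mF tF mUF; rewrite /law /pushforward preimage_bigcup.
apply: measure_semi_sigma_additive.
- by move=> n; rewrite -[X in measurable X]setTI; exact: mf.
- apply/trivIsetP => /= i j _ _ ij; rewrite -preimage_setI.
  by move/trivIsetP : tF => /(_ _ _ _ _ ij) ->//; rewrite preimage_set0.
- by rewrite -preimage_bigcup -[X in measurable X]setTI; exact: mf.
Qed.

HB.instance Definition _ := isMeasure.Build _ _ _ (law mf)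
  law0 law_ge0 law_sigma_additive.

Let law_fin : fin_num_fun (law mf).
Proof.
move=> A mA; apply: fin_num_measure.
by rewrite -[X in measurable X]setTI; exact: mf.
Qed.

HB.instance Definition _ := @Measure_isFinite.Build _ _ _ (law mf) law_fin.

Lemma ge0_integral_law (g : T' -> \bar R) : measurable_fun setT g ->
  (forall y, 0 <= g y) -> \int[law mf]_y g y = \int[m]_x g (f x).
Proof.
move=> mg g0; rewrite -[RHS](@ge0_integral_pushforward _ _ _ _ _ _ mf m setT g)//.
Qed.

End pushforward_finite.

Section independent_integral.
Local Open Scope ereal_scope.
Context d1 d2 d3 (T : measurableType d1) (T1 : measurableType d2)
  (T2 : measurableType d3) (R : realType).
Variables (m : {finite_measure set T -> \bar R}).
Variables (nu : {sigma_finite_measure set T2 -> \bar R}).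
Variables (Y : T -> T1) (X : T -> T2).
Hypotheses (mY : measurable_fun setT Y) (mX : measurable_fun setT X).
Hypothesis YX : forall A B, measurable A -> measurable B ->
  m ((Y @^-1` A) `&` (X @^-1` B)) = m (Y @^-1` A) * nu B.

(** By hypothesis the joint law of (Y, X) is a product on rectangles, hence on
    all measurable sets by uniqueness of product measures. *)
Lemma ge0_integral_independent (F : T1 * T2 -> \bar R) : measurable_fun setT F ->
  (forall p, 0 <= F p) ->
  \int[m]_w F (Y w, X w) = \int[m]_w \int[nu]_x F (Y w, x).
Proof.
move=> mF F0.
have mYX : measurable_fun setT (fun w => (Y w, X w)) by exact: measurable_fun_pair.
rewrite -(ge0_integral_law m mYX mF F0).
rewrite (@eq_measure_integral _ _ _ _ (law m mY \x nu)); last first.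
  move=> C mC _; apply/esym; apply: product_measure_unique => // A B mA mB; exact: YX.
rewrite fubini_tonelli1//.
rewrite ge0_integral_law//.
- exact: measurable_fun_fubini_tonelli_F.
- by move=> y; exact: integral_ge0.
Qed.

End independent_integral.

(** * Gaussian random walks that stay nonnegative *)

Section gaussian_walk.
Local Open Scope ereal_scope.
Context d (Omega : measurableType d) (R : realType) (P : probability Omega R).
Variables (N : nat) (X : nat -> Omega -> R) (h delta : nat -> R) (y0 : R).
Hypothesis mX : forall i, measurable_fun setT (X i).
Hypothesis h0 : forall i, (i < N)%N -> (0 < h i)%R.
Hypothesis y0_ge0 : (0 <= y0)%R.

Local Notation mu := (@lebesgue_measure R).
Local Notation D := (`[0%R, +oo[%classic : set R).

(** Constraints on the increments that the first k steps do not involve.  They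
    are carried through the induction of [integral_stays] to express that these
    increments are independent of the first k steps. *)
Definition tail_event (A : nat -> set R) k : set Omega :=
  [set w | forall i, (k <= i < N)%N -> A i (X i w)].

Hypothesis XE : forall i B, (i < N)%N -> measurable B ->
  P (X i @^-1` B) = normal_prob 0%R (Num.sqrt (h i)) B.
Hypothesis X_indep : forall A k, (k < N)%N -> (forall i, measurable (A i)) ->
  P (tail_event A k) = P (X k @^-1` A k) * P (tail_event A k.+1).

(** Distance between the boundary, which rises by [delta i] at step i, and the
    walk with increments [X i]. *)
Fixpoint gap n w : R :=
  if n is m.+1 then (gap m w + delta m - X m w)%R else y0.

Definition stays k : set Omega := [set w | forall i, (i <= k)%N -> (0 <= gap i w)%R].

Definition step_kernel i y z : R := heat (h i) (z - y - delta i).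

Fixpoint walk n (f : R -> \bar R) : R -> \bar R :=
  if n is m.+1 then walk m (kop (step_kernel m) f) else f.

Lemma measurable_gap n : measurable_fun setT (gap n).
Proof.
elim: n => [|n ih]; first exact: measurable_cst.
by apply: measurable_funB => //; exact: measurable_funD.
Qed.

Lemma measurable_tail_event A k : (forall i, measurable (A i)) ->
  measurable (tail_event A k).
Proof.
move=> mA; rewrite (_ : tail_event A k =
    \bigcap_(i in [set i | (k <= i < N)%N]) (X i @^-1` A i)).
  apply: bigcap_measurableType => i _.
  by rewrite -[X in measurable X]setTI; exact: mX.
by apply/seteqP; split => w wE i /wE.
Qed.

Lemma measurable_stays k : measurable (stays k).
Proof.
rewrite (_ : stays k = \bigcap_(i in [set i | (i <= k)%N]) (gap i @^-1` D)).
  apply: bigcap_measurableType => i _; rewrite -[X in measurable X]setTI.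
  by apply: measurable_gap => //; exact: measurable_itv.
apply/seteqP; split => w wE i /wE /=; rewrite in_itv/= andbT //.
Qed.

Lemma ge0_kernel_step i : ge0_kernel (step_kernel i).
Proof.
split; last by move=> *; exact: heat_ge0.
apply: measurable_heat_comp; apply: measurable_funB => //.
exact: measurable_funB.
Qed.

Lemma ge0_restr f : ge0_fun f ->
  measurable_fun setT (f \_ D) /\ (forall x : R, 0 <= (f \_ D) x).
Proof.
move=> [mf f0]; split; first by apply/(measurable_restrictT _ _).1.
by move=> x; rewrite patchE; case: ifPn => // /[!inE]/=; rewrite in_itv/= andbT => /f0.
Qed.

Lemma kop_stepE i f y : (i < N)%N -> ge0_fun f ->
  \int[normal_prob 0%R (Num.sqrt (h i))]_x (f \_ D) (y + delta i - x)%R =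
  kop (step_kernel i) f y.
Proof.
move=> iN fP; have hi0 := h0 iN.
have [mg g0] := ge0_restr fP.
have msub : measurable_fun setT (fun x : R => y + delta i - x)%R by exact: measurable_funB.
rewrite (ge0_integral_density (mu := mu) (p := heat (h i)))//; first last.
- exact: (measurableT_comp mg msub).
- by move=> x; exact: heat_ge0.
- exact: measurable_heat.
pose F z := (f \_ D) z * (heat (h i) (y + delta i - z))%:E.
transitivity (\int[mu]_x F (y + delta i - x)%R).
  by apply: eq_integral => x _; rewrite /F; congr (_ * (heat _ _)%:E); ring.
rewrite ge0_integral_subl; last 2 first.
- apply: emeasurable_funM => //; apply/measurable_EFinP.
  exact: measurable_heat_comp.
- by move=> x; rewrite /F mule_ge0// lee_fin heat_ge0.
rewrite /kop [RHS]integral_mkcond; apply: eq_integral => z _.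
rewrite /F /step_kernel !patchE; case: ifPn => _; last by rewrite mul0e.
by rewrite muleC -heatN//; congr ((heat _ _)%:E * _); ring.
Qed.

(** By induction on k.  The induction hypothesis for the indicator function of C,
    with B as constraint on the increment k, computes the probability of
    {gap k in C, X k in B}: it shows that X k is independent of gap k on the
    event that the walk has stayed nonnegative, so X k can be integrated out, and
    this produces the operator of [step_kernel k].  Functions on the half-line
    are extended by 0, which encodes the constraint on the last step. *)
Lemma integral_stays k f A : (k <= N)%N -> ge0_fun f ->
  (forall i, measurable (A i)) ->
  \int[P]_(w in stays k `&` tail_event A k) (f \_ D) (gap k w) =
  P (tail_event A k) * walk k f y0.
Proof.
elim: k f A => [|k ih] f A kN fP mA.
  have y0D : y0 \in D by rewrite inE/= in_itv/= y0_ge0.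
  have -> : stays 0 = setT.
    by apply/seteqP; split => // w _ i; rewrite leqn0 => /eqP ->.
  rewrite setTI /=; under eq_integral do rewrite patchE y0D.
  rewrite integral_cst; last exact: measurable_tail_event.
  by rewrite muleC.
have kN' : (k < N)%N by [].
have fkP := measurable_kop (ge0_kernel_step k) fP.
pose A' B i := if i == k then B else A i.
have mA' B : measurable B -> forall i, measurable (A' B i).
  by move=> mB i; rewrite /A'; case: ifPn.
have tailE B : tail_event (A' B) k = X k @^-1` B `&` tail_event A k.+1.
  apply/seteqP; split => w /=.
    move=> Hw; split; first by have := Hw k; rewrite /A' eqxx leqnn; exact.
    move=> i /andP[ki iN]; have := Hw i.
    by rewrite /A' gtn_eqF// (ltnW ki) iN; exact.
  move=> [wB Hw] i /andP[ki iN]; rewrite /A'; case: eqP => [->//|/eqP ik].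
  by apply: Hw; rewrite iN ltn_neqAle eq_sym ik ki.
have tailT : tail_event (A' setT) k = tail_event A k.+1.
  by rewrite tailE preimage_setT setTI.
have tailEA B : measurable B ->
    P (tail_event (A' B) k) = P (X k @^-1` B) * P (tail_event A k.+1).
  move=> mB; rewrite X_indep//; last exact: mA'.
  congr (P _ * P _); first by rewrite /A' eqxx.
  apply/seteqP; split => w Hw i /andP[ki iN].
    by have := Hw i; rewrite ki iN /A' gtn_eqF//; exact.
  by rewrite /A' gtn_eqF//; apply: Hw; rewrite ki.
have mS : measurable (stays k `&` tail_event A k.+1).
  by apply: measurableI; [exact: measurable_stays|exact: measurable_tail_event].
pose m : {finite_measure set Omega -> \bar R} := mrestr P mS.
have E1 (F : Omega -> \bar R) : measurable_fun setT F -> (forall x, 0 <= F x) ->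
    \int[P]_(w in stays k `&` tail_event A k.+1) F w = \int[m]_w F w.
  move=> mF F0; rewrite (ge0_integral_density (mu := P)
    (p := \1_(stays k `&` tail_event A k.+1)))//.
  - rewrite [LHS]integral_mkcond; apply: eq_integral => w _.
    by rewrite patchE indicE; case: ifPn => _; rewrite ?mule1 ?mule0.
  - by move=> B mB; rewrite integral_indic// setIC.
have mg := measurable_gap k.
have joint C B : measurable C -> measurable B ->
    m ((gap k @^-1` C) `&` (X k @^-1` B)) =
    P (X k @^-1` B) * P (tail_event A k.+1) * walk k (EFin \o \1_C) y0.
  move=> mC mB; rewrite -tailEA// -ih//; [|exact: ltnW| |exact: mA'].
  - transitivity (\int[P]_(w in stays k `&` tail_event (A' B) k)
        (\1_(gap k @^-1` C) w)%:E).
      rewrite integral_indic; last 2 first.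
      - apply: measurableI; first exact: measurable_stays.
        by apply: measurable_tail_event; exact: mA'.
      - by rewrite -[X in measurable X]setTI; exact: mg.
      rewrite /m/= /mrestr/= tailE; congr (P _).
      by apply/seteqP; split => w /=; tauto.
    apply: eq_integral => w /set_mem[Sw _]; rewrite patchE mem_set//=.
    by rewrite in_itv/= andbT; exact: Sw.
  - split; first by apply/measurable_EFinP; exact: measurable_funTS.
    by move=> z _; rewrite lee_fin.
have [mgf gf0] := ge0_restr fP.
have -> : P (tail_event A k.+1) * walk k.+1 f y0 =
  \int[P]_(w in stays k `&` tail_event A k.+1) (kop (step_kernel k) f) (gap k w).
  rewrite -tailT -ih//; [|exact: ltnW|exact: mA'].
  apply: eq_integral => w /set_mem[Sw _]; rewrite patchE mem_set//=.
  by rewrite in_itv/= andbT; exact: Sw.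
transitivity (\int[P]_(w in stays k `&` tail_event A k.+1)
    (f \_ D) (gap k w + delta k - X k w)%R).
  rewrite [LHS]integral_mkcond [RHS]integral_mkcond; apply: eq_integral => w _.
  rewrite [LHS]patchE [RHS]patchE.
  case: ifPn => [/set_mem[Sw Rw]|SRw].
    rewrite mem_set//; split => // i ik; apply: Sw; exact: leqW.
  case: ifPn => // /set_mem[Sw Rw]; rewrite patchE memNset//=.
  rewrite in_itv/= andbT => g0; move: SRw; rewrite notin_setE; apply.
  split => // i; rewrite leq_eqVlt => /predU1P[->//|ik].
  exact: Sw.
pose F (p : R * R) := (f \_ D) (p.1 + delta k - p.2)%R.
have mF : measurable_fun setT F.
  have m2 : measurable_fun setT (fun p : R * R => p.1 + delta k - p.2)%R.
    by apply: measurable_funB => //; exact: measurable_funD.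
  exact: (measurableT_comp mgf m2).
have F0 p : 0 <= F p by exact: gf0.
rewrite E1; last 2 first.
- exact: (measurableT_comp mF (measurable_fun_pair mg (mX k))).
- by move=> w; exact: gf0.
rewrite (@ge0_integral_independent _ _ _ _ R (measurableTypeR R) _ m
  (normal_prob 0%R (Num.sqrt (h k))) _ _ mg (mX k) _ F)//.
  rewrite -E1.
  - by apply: eq_integral => w _; exact: kop_stepE.
  - exact: (measurableT_comp (measurable_fun_fubini_tonelli_F
      (m2 := normal_prob 0%R (Num.sqrt (h k))) _ mF F0) mg).
  - by move=> w; apply: integral_ge0 => x _; exact: F0.
move=> C B mC mB; have := joint C setT mC measurableT.
rewrite preimage_setT setIT probability_setT mul1e => ->.
by rewrite joint// XE// -muleA muleC.
Qed.

End gaussian_walk.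

(** * Refining the grid and removing the shift *)

Section limits.
Context {R : realType}.
Local Notation mu := (@lebesgue_measure R).
Local Notation D := (`[0%R, +oo[%classic : set R).
Implicit Types (c h s y z w e u : R) (f g : R -> \bar R).

Lemma bernoulli_ge (x : R) n : 0 <= x <= 1 -> 1 - n%:R * x <= (1 - x) ^+ n.
Proof.
move=> /andP[x0 x1]; elim: n => [|n ih]; first by rewrite mul0r subr0.
rewrite exprS; apply: le_trans (ler_wpM2l _ ih); last by rewrite subr_ge0.
rewrite -natr1; have : 0 <= n%:R * x * x by rewrite !mulr_ge0.
nra.
Qed.

(** With x = exp (- al (n + 1)), Bernoulli's inequality bounds the distance of
    (1 - x) ^ (n + 1) to 1 by (n + 1) x, which tends to 0 because
    exp t >= t ^ 2 / 4. *)
Lemma cvg_overshoot e u : 0 < e -> 0 < u ->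
  overshoot e (u / n.+1%:R) ^+ n.+1 @[n --> \oo] --> (1 : R).
Proof.
move=> e0 u0; pose al := 2 * e ^+ 2 / u.
have al0 : 0 < al by rewrite divr_gt0// mulr_gt0// exprn_gt0.
pose x n := expR (- (al * n.+1%:R)).
rewrite (_ : (fun n => _) = (fun n => ((1 - x n) ^+ n.+1)^-1)); last first.
  apply/funext => n; rewrite /overshoot exprVn; congr (((1 - expR (- _)) ^+ _)^-1).
  by rewrite /al invfM invrK mulrA.
rewrite -[X in _ --> X]invr1; apply: cvgV; first exact: oner_neq0.
have x01 n : 0 <= x n <= 1.
  by rewrite expR_ge0/= -[leRHS]expR0 ler_expR oppr_le0 mulr_ge0// ltW.
have xn n : n.+1%:R * x n <= 4 / al ^+ 2 * n.+1%:R^-1.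
  rewrite /x expRN; set t := al * n.+1%:R.
  have t0 : 0 < t by rewrite mulr_gt0.
  have : t ^+ 2 / 4 <= expR t.
    have -> : expR t = expR (t / 2) ^+ 2.
      by rewrite expr2 -expRD -splitr.
    have -> : t ^+ 2 / 4 = (t / 2) ^+ 2 by field.
    rewrite ler_pXn2r// ?nnegrE ?expR_ge0 ?divr_ge0 ?ltW//.
    by have := expR_ge1Dx (t / 2); lra.
  move=> le1; rewrite ler_pdivrMr ?expR_gt0//.
  apply: le_trans (ler_wpM2l _ le1); last first.
    by rewrite mulr_ge0 ?invr_ge0// divr_ge0// sqr_ge0.
  rewrite le_eqVlt; apply/orP; left; apply/eqP; rewrite /t; field.
  by rewrite gt_eqF//= lt0r_neq0.
apply: (@squeeze_cvgr _ _ _ _ (fun n => 1 - 4 / al ^+ 2 * n.+1%:R^-1) (cst 1)).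
- apply: nearW => n; apply/andP; split.
    apply: le_trans (bernoulli_ge _ (x01 n)); rewrite lerB//.
  have /andP[x0 x1] := x01 n.
  by rewrite exprn_ile1// ?subr_ge0// lerBlDr lerDl.
- rewrite -[X in _ --> X](subr0 1) -[X in _ --> _ - X](mulr0 (4 / al ^+ 2)).
  apply: cvgB; first exact: cvg_cst.
  by apply: cvgM; [exact: cvg_cst|exact: cvg_harmonic].
- exact: cvg_cst.
Qed.

Lemma cvg_killed_at c s y z :
  killed_at (n.+1%:R^-1) c s y z @[n --> \oo] --> killed c s y z.
Proof.
have cn w : w + n.+1%:R^-1 @[n --> \oo] --> w.
  rewrite -[X in _ --> X]addr0; apply: cvgD; first exact: cvg_cst.
  exact: cvg_harmonic.
rewrite (_ : (fun n => _) = (fun n => heat s (z - y - c * s) *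
  (1 - expR (- (2 * (y + n.+1%:R^-1) * (z + n.+1%:R^-1) / s))))); last first.
  apply/funext => n; rewrite /killed_at /killed; congr (heat _ _ * _); ring.
apply: cvgM; first exact: cvg_cst.
apply: cvgB; first exact: cvg_cst.
apply: (cvg_comp _ expR); last exact: continuous_expR.
apply: cvgN; apply: cvgM; last exact: cvg_cst.
by apply: cvgM; [apply: cvgM; [exact: cvg_cst|]|].
Qed.

(** Dominated convergence: a killed kernel is below the Gaussian density. *)
Lemma cvg_kop_killed_at c s (f_ : nat -> R -> \bar R) f y : 0 < s -> 0 <= y ->
  (forall n, ge0_fun (f_ n)) -> ge0_fun f ->
  (forall n z, 0 <= z -> (f_ n z <= 1)%E) ->
  (forall z, 0 <= z -> f_ n z @[n --> \oo] --> f z) ->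
  kop (killed_at (n.+1%:R^-1) c s) (f_ n) y @[n --> \oo] --> kop (killed c s) f y.
Proof.
move=> s0 y0 f_P fP f_1 f_f.
have kP n : ge0_kernel (killed_at (n.+1%:R^-1) c s).
  by apply: ge0_kernel_killed_at.
have k0P : ge0_kernel (killed c s).
  exact: ge0_kernel_killed.
have inD z : D z -> 0 <= z by rewrite /= in_itv/= andbT.
have [] // := @dominated_convergence _ _ R mu D (measurable_itv _)
  (fun n z => ((killed_at (n.+1%:R^-1) c s y z)%:E * f_ n z)%E)
  (fun z => ((killed c s y z)%:E * f z)%E)
  (fun z => (heat s (z - (y + c * s)))%:E).
- by move=> n; exact: (ge0_funM (ge0_kernel_fun (kP n) y0) (f_P n)).1.
- exact: (ge0_funM (ge0_kernel_fun k0P y0) fP).1.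
- apply: aeW => z /inD z0.
  have f1 : (f z <= 1)%E.
    apply: (cvge_le _ (f_f z z0)).
    by apply: nearW => n; exact: f_1.
  apply: cvgeM.
  + apply: mule_def_fin => //; rewrite ge0_fin_numE ?fP.2//.
    by rewrite (le_lt_trans f1)// ltry.
  + by apply: cvg_EFin; [exact: nearW|exact: cvg_killed_at].
  + exact: f_f.
- apply/integrableP; split.
    apply/measurable_EFinP/measurable_funTS/measurable_heat_comp.
    exact: measurable_funB.
  apply: (@le_lt_trans _ _ (\int[mu]_z (heat s (z - (y + c * s)))%:E)%E).
    under eq_integral do rewrite gee0_abs ?lee_fin ?heat_ge0//.
    apply: ge0_subset_integral => //.
    + apply/measurable_EFinP/measurable_heat_comp.
      exact: measurable_funB.
    + by move=> z _; rewrite lee_fin heat_ge0.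
  by rewrite integral_heat// ltry.
- apply: aeW => z n /inD z0.
  rewrite gee0_abs; last by rewrite mule_ge0 ?(f_P n).2// lee_fin (kP n).2.
  apply: (@le_trans _ _ ((killed_at (n.+1%:R^-1) c s y z)%:E * 1)%E).
    by rewrite lee_wpmul2l ?f_1// lee_fin (kP n).2.
  rewrite mule1 lee_fin; apply: (le_trans (killed_le _ _ _ _)).
  by rewrite le_eqVlt; apply/orP; left; apply/eqP; congr heat; ring.
Qed.

End limits.

(** * Brownian motion observed on a grid *)

Lemma walk_two_kernels (R : realType) (h delta : nat -> R) (k1 k2 : R -> R -> R)
    n m f :
  (forall i, (i < n)%N -> step_kernel h delta i = k1) ->
  (forall i, (n <= i)%N -> step_kernel h delta i = k2) ->
  walk h delta (n + m) f = iter n (kop k1) (iter m (kop k2) f).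
Proof.
move=> e1 e2; elim: m f => [|m ih] f.
  rewrite addn0/=; elim: n f e1 {e2} => // n ih f e1.
  by rewrite iterSr /= e1// ih// => i ni; apply: e1; exact: ltnW.
by rewrite addnS iterSr /= ih e2// leq_addr.
Qed.

Section brownian_grid.
Context d (Omega : measurableType d) (R : realType) (P : probability Omega R).
Variables (B : R -> {RV P >-> R}) (hB : standard_brownian_motion P B).
Variables (a c c' u s : R).
Hypotheses (a0 : 0 <= a) (u0 : 0 < u) (s0 : 0 < s).

(** The broken line is parametrized on its second piece by the time elapsed
    since u. *)
Definition stays_below : set Omega :=
  [set w | (forall t, 0 <= t <= u -> B t w <= a + c * t) /\
           (forall t, 0 <= t <= s -> B (u + t) w <= a + c * u + c' * t)].

Definition grid_below m : set Omega :=
  [set w | (forall i, (i <= m)%N ->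
              B (i%:R * (u / m%:R)) w <= a + c * (i%:R * (u / m%:R))) /\
           (forall i, (i <= m)%N ->
              B (u + i%:R * (s / m%:R)) w <= a + c * u + c' * (i%:R * (s / m%:R)))].

Section one_grid.
Variable m : nat.
Hypothesis m0 : (0 < m)%N.

(* The two formulas agree at i = m; the same holds for [bound]. *)
Let t i : R := if (i <= m)%N then i%:R * (u / m%:R) else u + (i - m)%:R * (s / m%:R).
Let h i : R := if (i < m)%N then u / m%:R else s / m%:R.
Let delta i : R := if (i < m)%N then c * (u / m%:R) else c' * (s / m%:R).
Let X i w := B (t i.+1) w - B (t i) w.

Let m0R : (0 : R) < m%:R. Proof. by rewrite ltr0n. Qed.

Let mu_m : m%:R * (u / m%:R) = u.
Proof. by rewrite mulrC divfK// gt_eqF. Qed.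

Let h0 i : 0 < h i.
Proof. by rewrite /h; case: ifP => _; rewrite divr_gt0. Qed.

Let t_step i : t i.+1 = t i + h i.
Proof.
rewrite /t /h; case: (ltngtP i m) => im.
- by rewrite -natr1 mulrDl mul1r.
- by rewrite subSn 1?ltnW// -natr1; ring.
- by rewrite im subSnn mul1r mu_m.
Qed.

Let t_lt i : t i < t i.+1.
Proof. by rewrite t_step ltrDl. Qed.

Let t0 : t 0 = 0.
Proof. by rewrite /t mul0r. Qed.

Let t_ge0 i : 0 <= t i.
Proof. by elim: i => [|i ih]; rewrite ?t0// (le_trans ih)// ltW. Qed.

Let bound i : R :=
  if (i <= m)%N then a + c * (i%:R * (u / m%:R))
  else a + c * u + c' * ((i - m)%:R * (s / m%:R)).

Let gapE i w : gap X delta a i w = bound i - (B (t i) w - B 0 w).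
Proof.
elim: i => [|i ih] /=; first by rewrite /bound t0 subrr subr0 mul0r mulr0 addr0.
rewrite ih /X; suff -> : bound i.+1 = bound i + delta i by ring.
rewrite /bound /delta; case: (ltngtP i m) => im.
- by rewrite -natr1; ring.
- by rewrite subSn 1?ltnW// -natr1; ring.
- by rewrite im subSnn mul1r mu_m.
Qed.

Let grid_belowE w : B 0 w = 0 -> grid_below m w <-> stays X delta a (m + m) w.
Proof.
move=> B0; split.
  move=> [w1 w2] i imm; rewrite gapE B0 subr0 subr_ge0 /bound /t.
  case: ifPn => im; first exact: w1.
  by apply: w2; rewrite leq_subLR.
move=> wS; split => i im.
  have := wS i (leq_trans im (leq_addr _ _)).
  by rewrite gapE B0 subr0 subr_ge0 /bound /t im.
have := wS (m + i)%N; rewrite leq_add2l => /(_ im).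
rewrite gapE B0 subr0 subr_ge0 /bound /t addKn -[X in (_ <= X)%N]addn0 leq_add2l.
case: i im => [_|i _] /=; last exact.
by rewrite addn0 mu_m mul0r mulr0 !addr0.
Qed.

Let mX i : measurable_fun setT (X i).
Proof. by apply: measurable_funB. Qed.

Let XE i A : (i < m + m)%N -> measurable A ->
  P (X i @^-1` A) = normal_prob 0 (Num.sqrt (h i)) A.
Proof.
move=> _ mA; have -> : h i = t i.+1 - t i by rewrite t_step addrC addKr.
by rewrite -(bm_normal hB (t_ge0 i) (t_lt i)).
Qed.

Let X_indep (A : nat -> set R) k : (k < m + m)%N -> (forall i, measurable (A i)) ->
  P (tail_event (m + m) X A k) = (P (X k @^-1` A k) * P (tail_event (m + m) X A k.+1))%E.
Proof.
move=> kN mA.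
pose J j : {set 'I_(m + m)} := [set i : 'I_(m + m) | (j <= i)%N]%SET.
have tailE j : P (tail_event (m + m) X A j) =
    (\prod_(i in J j) P (X i @^-1` A i))%E.
  have := @bm_independent _ _ _ _ _ hB (m + m)%N t (t_ge0 0) (fun i _ => t_lt i)
    (J j) (fun i : 'I_(m + m) => A i) (fun i => mA i).
  move=> <-; congr (P _); apply/seteqP; split => w Hw.
    by move=> i; rewrite inE => ji; apply: Hw; rewrite ji ltn_ord.
  move=> i /andP[ji iN]; have := Hw (Ordinal iN); rewrite inE; exact.
rewrite !tailE (bigD1 (Ordinal kN)) ?inE//=; congr (_ * _)%E.
by apply: eq_bigl => i; rewrite !inE -val_eqE/= andbC eq_sym -ltn_neqAle.
Qed.

(* The motion starts at 0 almost surely only. *)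
Let prob_eq_of_start0 A A' : measurable A -> measurable A' ->
  (forall w, B 0 w = 0 -> A w <-> A' w) -> P A = P A'.
Proof.
move=> mA mA' AA'; have [Z [mZ PZ0 BZ]] := bm_start hB.
have key C : measurable C -> P C = P (C `\` Z).
  move=> mC; apply: (etrans (measureDI P mC mZ)); rewrite -[RHS]adde0.
  by congr (_ + _)%E; apply: subset_measure0 PZ0 => //; exact: measurableI.
rewrite (key A)// (key A')//; congr (P _).
apply/seteqP; split => w [Aw Zw]; split => //; apply/AA' => //;
 by apply: contrapT => ?; apply: Zw; exact: BZ.
Qed.

Lemma measurable_grid_below : measurable (grid_below m).
Proof.
have mB r b : measurable [set w | B r w <= b].
  rewrite (_ : [set w | _] = B r @^-1` `]-oo, b]%classic).
    by rewrite -[X in measurable X]setTI; exact: measurable_funP.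
  by apply/seteqP; split => w /=; rewrite in_itv.
apply: measurableI.
- rewrite [X in measurable X](_ : _ = \bigcap_(i in [set i | (i <= m)%N])
    [set w | B (i%:R * (u / m%:R)) w <= a + c * (i%:R * (u / m%:R))]).
    by apply: bigcap_measurableType => i _; exact: mB.
  by apply/seteqP; split => w Hw i /Hw.
- rewrite [X in measurable X](_ : _ = \bigcap_(i in [set i | (i <= m)%N])
    [set w | B (u + i%:R * (s / m%:R)) w <= a + c * u + c' * (i%:R * (s / m%:R))]).
    by apply: bigcap_measurableType => i _; exact: mB.
  by apply/seteqP; split => w Hw i /Hw.
Qed.

Lemma prob_grid_below : P (grid_below m) =
  iter m (kop (drifted c (u / m%:R))) (iter m (kop (drifted c' (s / m%:R))) (cst 1%E)) a.
Proof.
rewrite -(@walk_two_kernels _ h delta); last 2 first.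
- by move=> i im; apply/funext => y; apply/funext => z; rewrite /step_kernel /h /delta im.
- move=> i im; apply/funext => y; apply/funext => z.
  by rewrite /step_kernel /h /delta ltnNge im.
have f1P : ge0_fun (cst 1%E : R -> \bar R) by split.
have mstays := measurable_stays delta a mX (m + m).
rewrite (prob_eq_of_start0 measurable_grid_below mstays grid_belowE).
have := integral_stays delta mX (fun i _ => h0 i) a0 XE X_indep (leqnn (m + m)) f1P
  (A := fun=> setT) (fun=> measurableT).
have -> : tail_event (m + m) X (fun=> setT) (m + m) = setT by apply/seteqP; split.
rewrite setIT probability_setT mul1e => <-.
rewrite -[LHS]mul1e -integral_cst//; apply: eq_integral => w /set_mem Sw.
by rewrite patchE mem_set//= in_itv/= andbT; exact: Sw.
Qed.

End one_grid.
End brownian_grid.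

(** * Brownian motion below a broken line *)

Section brownian_limit.
Context d (Omega : measurableType d) (R : realType) (P : probability Omega R).
Variables (B : R -> {RV P >-> R}) (hB : standard_brownian_motion P B).
Local Notation D := (`[0%R, +oo[%classic : set R).

(** The dyadic subdivisions are dense, and f is continuous from within the
    half-line. *)
Lemma ge0_dyadic (f : R -> R) (p s : R) : 0 <= p -> 0 < s ->
  {within `[0, +oo[, continuous f} ->
  (forall k i, (i <= 2 ^ k)%N -> 0 <= f (p + i%:R * (s / (2 ^ k)%:R))) ->
  forall t, 0 <= t <= s -> 0 <= f (p + t).
Proof.
move=> p0 s0 cf fge0 t /andP[t0 ts]; rewrite leNgt; apply/negP => fneg.
have pt0 : `[0, +oo[%classic (p + t) by rewrite /= in_itv/= andbT addr_ge0.
have : \forall y \near within `[0, +oo[ (nbhs (p + t)), f y < 0.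
  rewrite (nbhs_subspace_in pt0).
  exact: (cf (p + t) [set y | y < 0] (lt_nbhsl fneg)).
rewrite /within/= => -[e /= e0 He].
(* The index of the subdivision may be any k > s / e, since 2 ^ k > k. *)
have [k ske] : exists k, s / (2 ^ k)%:R < e.
  exists (Num.truncn (s / e)); set k := Num.truncn _.
  have se0 : 0 <= s / e by rewrite divr_ge0// ltW.
  have /andP[_ sek] := truncn_itv se0.
  rewrite ltr_pdivrMr ?ltr0n ?expn_gt0// mulrC -ltr_pdivrMr//.
  by rewrite (lt_le_trans sek)// ler_nat ltn_expl.
have m0 : (0 : R) < (2 ^ k)%:R by rewrite ltr0n expn_gt0.
have sm0 : 0 < s / (2 ^ k)%:R by rewrite divr_gt0.
pose x := t / (s / (2 ^ k)%:R).
have x0 : 0 <= x by rewrite divr_ge0// ltW.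
have /andP[ix xi] := truncn_itv x0.
pose i := Num.truncn x.
have im : (i <= 2 ^ k)%N.
  rewrite -(ler_nat R); apply: le_trans ix _; rewrite /x ler_pdivrMr//.
  by rewrite mulrC divfK// lt0r_neq0.
have := fge0 k i im; rewrite leNgt => /negP; apply.
move: ix xi; rewrite -/i /x ler_pdivlMr// ltr_pdivrMr// -natr1 mulrDl mul1r => ix xi.
apply: He; last first.
  by rewrite /= in_itv/= andbT addr_ge0// mulr_ge0// ltW.
rewrite /ball/= ltr_norml; apply/andP; split; lra.
Qed.

Section two_segments.
Variables (a c c' u s : R).
Hypotheses (a0 : 0 <= a) (u0 : 0 < u) (s0 : 0 < s).

Local Notation S := (stays_below B a c c' u s).
Local Notation G m := (grid_below B a c c' u s m).

Let grid_range (r : R) m i : 0 < r -> (0 < m)%N -> (i <= m)%N ->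
  0 <= i%:R * (r / m%:R) <= r.
Proof.
move=> r0 m0 im; have m0' : (0 : R) < m%:R by rewrite ltr0n.
rewrite mulrA divr_ge0 ?mulr_ge0 ?(ltW r0) ?(ltW m0')//= ler_pdivrMr//.
by rewrite (mulrC r) ler_pM2r// ler_nat.
Qed.

Lemma bigcap_grid_below : S = \bigcap_k G (2 ^ k)%N.
Proof.
apply/seteqP; split => w.
  by move=> [w1 w2] k _; split => i ik; [apply: w1|apply: w2];
    apply: grid_range => //; exact: expn_gt0.
move=> Gw; have cB := @bm_continuous _ _ _ _ _ hB w.
have cline (p q : R) : {within `[0, +oo[, continuous (fun t => p + q * t - B t w)}.
  have cl : {within `[0, +oo[, continuous (fun t : R => p + q * t)}.
    apply: continuous_subspaceT => x; apply: cvgD; first exact: cvg_cst.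
    by apply: cvgM; [exact: cvg_cst|exact: cvg_id].
  by move=> x; apply: (@cvgB _ R^o); [exact: cl|exact: cB].
split => t tr; rewrite -subr_ge0.
- rewrite -[t]add0r.
  apply: (@ge0_dyadic (fun t => a + c * t - B t w) 0 u) => //.
  by move=> k i ik; rewrite add0r subr_ge0; apply: (Gw k _).1.
- have -> : a + c * u + c' * t = a + c * u + c' * ((u + t) - u) by ring.
  apply: (@ge0_dyadic (fun t => a + c * u + c' * (t - u) - B t w) u s) => //.
  + exact: ltW.
  + rewrite (_ : (fun r => _) = fun r => a + c * u - c' * u + c' * r - B r w).
      exact: cline.
    by apply/funext => r; ring.
  + move=> k i ik; rewrite subr_ge0 (addrC u) addrK addrC.
    by apply: (Gw k _).2.
Qed.

Lemma measurable_stays_below : measurable S.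
Proof.
rewrite bigcap_grid_below; apply: bigcap_measurableType => k _.
exact: measurable_grid_below.
Qed.

(** The point of index i in a grid is the point of index 2i in the next one. *)
Lemma nonincreasing_grid_below : nonincreasing_seq (fun k => G (2 ^ k)%N).
Proof.
apply/nonincreasing_seqP => k; apply/subsetPset => w [w1 w2].
have half (r : R) i : i%:R * (r / (2 ^ k)%:R) = (2 * i)%:R * (r / (2 ^ k.+1)%:R).
  have p0 : (2 ^ k)%:R != 0 :> R by rewrite pnatr_eq0 -lt0n expn_gt0.
  by rewrite expnS !natrM; field.
by split => i ik; rewrite half; [apply: w1|apply: w2]; rewrite expnS leq_mul2l.
Qed.

Let cst1 : ge0_fun (cst 1%E : R -> \bar R). Proof. by split. Qed.

Let mulrdiv (n : nat) (r : R) : n.+1%:R * (r / n.+1%:R) = r.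
Proof. by rewrite mulrC divfK// pnatr_eq0. Qed.

Lemma killed_le_grid_below n :
  (kop (killed c u) (kop (killed c' s) (cst 1)) a <= P (G n.+1))%E.
Proof.
have un : 0 < u / n.+1%:R by rewrite divr_gt0.
have sn : 0 < s / n.+1%:R by rewrite divr_gt0.
rewrite prob_grid_below//.
have itP := ge0_fun_iter n.+1 (ge0_kernel_drifted c' (s / n.+1%:R)) cst1.
have k1P := ge0_kernel_killed c u0; have k2P := ge0_kernel_killed c' s0.
apply: le_trans (kop_killed_le_iter c n un itP a0).
rewrite mulrdiv; apply: le_kop => //; first exact: measurable_kop.
by move=> z z0; have := kop_killed_le_iter c' n sn cst1 z0; rewrite mulrdiv.
Qed.

Lemma grid_below_le_killed_at e n : 0 < e ->
  (P (G n.+1) <=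
   (overshoot e (u / n.+1%:R) ^+ n.+1 * overshoot e (s / n.+1%:R) ^+ n.+1)%:E *
   kop (killed_at e c u) (kop (killed_at e c' s) (cst 1)) a)%E.
Proof.
move=> e0.
have un : 0 < u / n.+1%:R by rewrite divr_gt0.
have sn : 0 < s / n.+1%:R by rewrite divr_gt0.
have ov1 := exprn_ge0 n.+1 (overshoot_ge0 e un).
have ov2 := exprn_ge0 n.+1 (overshoot_ge0 e sn).
have k1P := ge0_kernel_killed_at c (ltW e0) u0.
have k2P := ge0_kernel_killed_at c' (ltW e0) s0.
have itP := ge0_fun_iter n.+1 (ge0_kernel_drifted c' (s / n.+1%:R)) cst1.
have kP := measurable_kop k2P cst1.
rewrite prob_grid_below//.
apply: (le_trans (iter_le_kop_killed_at c n e0 un itP a0)).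
rewrite mulrdiv EFinM -muleA; apply: lee_wpmul2l; first by rewrite lee_fin.
rewrite -kopZl//; apply: le_kop => //.
  split; last by move=> z z0; rewrite mule_ge0 ?lee_fin// kP.2.
  by apply: emeasurable_funM => //; exact: kP.1.
by move=> z z0; have := iter_le_kop_killed_at c' n e0 sn cst1 z0; rewrite mulrdiv.
Qed.

Let kop_killed_at_le1 (e c1 h : R) (f : R -> \bar R) (y : R) : 0 <= e -> 0 < h -> ge0_fun f ->
  (forall z : R, 0 <= z -> (f z <= 1)%E) -> 0 <= y ->
  (kop (killed_at e c1 h) f y <= 1)%E.
Proof.
move=> e0 h0 fP f1 y0; have kP := ge0_kernel_killed_at c1 e0 h0.
have dP := ge0_kernel_drifted c1 h.
apply: (@le_trans _ _ (kop (drifted c1 h) (cst 1%E) y)).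
  apply: le_kop => // z z0; rewrite /killed_at; apply: le_trans (killed_le _ _ _ _) _.
  by rewrite le_eqVlt; apply/orP; left; apply/eqP; congr heat; ring.
rewrite -[leRHS](integral_heat (y + c1 * h) h0) /kop.
apply: (@le_trans _ _
    (\int[lebesgue_measure]_(z in D) (heat h (z - (y + c1 * h)))%:E)%E).
  rewrite le_eqVlt; apply/orP; left; apply/eqP; apply: eq_integral => z _.
  by rewrite /= mule1 /drifted -addrA -opprD.
apply: ge0_subset_integral => //.
- apply/measurable_EFinP/measurable_heat_comp; exact: measurable_funB.
- by move=> z _; rewrite lee_fin heat_ge0.
Qed.

(** The grid probabilities decrease to the probability of the event, so that a
    lower bound valid on every grid passes to the limit.  Conversely each of them
    is an upper bound; along the grids, the factors in
    [grid_below_le_killed_at] tend to 1, and then e = 1 / (n + 1) tends to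
    0. *)
Lemma prob_stays_below :
  P S = kop (killed c u) (kop (killed c' s) (cst 1%E)) a.
Proof.
have mS := measurable_stays_below.
apply/eqP; rewrite eq_le; apply/andP; split; last first.
  have cvgP : P (G (2 ^ k)%N) @[k --> \oo] --> P S.
    rewrite bigcap_grid_below; apply: nonincreasing_cvg_mu.
    - by rewrite (le_lt_trans (probability_le1 P _)) ?ltry//; exact: measurable_grid_below.
    - by move=> i; exact: measurable_grid_below.
    - by rewrite -bigcap_grid_below.
    - exact: nonincreasing_grid_below.
  apply: (cvge_ge _ cvgP); apply: nearW => k.
  by rewrite -(prednK (expn_gt0 2 k)); exact: killed_le_grid_below.
have SG n : (P S <= P (G n.+1))%E.
  apply: le_measure; rewrite ?inE//; first exact: measurable_grid_below.
  by move=> w [w1 w2]; split => i ik; [apply: w1|apply: w2]; exact: grid_range.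
have upper e : 0 < e ->
    (P S <= kop (killed_at e c u) (kop (killed_at e c' s) (cst 1)) a)%E.
  move=> e0; set Q := kop _ _ _.
  have Qfin : Q \is a fin_num.
    have k2P := ge0_kernel_killed_at c' (ltW e0) s0.
    have kP := measurable_kop k2P cst1.
    have [_ Q0] := measurable_kop (ge0_kernel_killed_at c (ltW e0) u0) kP.
    rewrite ge0_fin_numE ?Q0// (@le_lt_trans _ _ 1%E) ?ltry//.
    by apply: kop_killed_at_le1 => // [|z z0]; [|apply: kop_killed_at_le1 => //];
      exact: ltW.
  have : ((overshoot e (u / n.+1%:R) ^+ n.+1 * overshoot e (s / n.+1%:R) ^+ n.+1)%:E * Q)%E
      @[n --> \oo] --> Q.
    rewrite -[X in _ --> X]mul1e; apply: cvgeZr => //.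
    apply: cvg_EFin; first exact: nearW.
    by rewrite -[X in _ --> X](mulr1 1); apply: cvgM; exact: cvg_overshoot.
  apply: cvge_ge; apply: nearW => n.
  by apply: (le_trans (SG n)); exact: grid_below_le_killed_at.
have : kop (killed_at n.+1%:R^-1 c u) (kop (killed_at n.+1%:R^-1 c' s) (cst 1%E)) a
    @[n --> \oo] --> kop (killed c u) (kop (killed c' s) (cst 1%E)) a.
  have kSP c1 h n : 0 < h -> ge0_kernel (killed_at (n.+1%:R^-1 : R) c1 h).
    by move=> h0; exact: ge0_kernel_killed_at.
  apply: cvg_kop_killed_at => //.
  - by move=> n; apply: measurable_kop => //; exact: kSP.
  - by apply: measurable_kop => //; exact: ge0_kernel_killed.
  - by move=> n z z0; exact: kop_killed_at_le1.
  - move=> z z0; apply: (@cvg_kop_killed_at _ c' s (fun=> cst 1%E)) => //.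
    by move=> x _; exact: cvg_cst.
by apply: cvge_ge; apply: nearW => n; exact: upper.
Qed.

End two_segments.
End brownian_limit.

(** * Half-line and quadrant integrals of Gaussian densities *)

Section normal_tails.
Context {R : realType}.
Local Notation mu := (@lebesgue_measure R).
Local Notation D := (`[0%R, +oo[%classic : set R).
Implicit Types (x y z r : R).

Let measurable_gt r : measurable [set z : R | r < z].
Proof.
rewrite [X in measurable X](_ : _ = `]r, +oo[%classic); first exact: measurable_itv.
by apply/seteqP; split => z /=; rewrite in_itv/= andbT.
Qed.

Let measurable_gt_fun d (T : measurableType d) (f : T -> R) r :
  measurable_fun setT f -> measurable [set w | r < f w].
Proof.
by move=> mf; have := mf measurableT _ (measurable_gt r); rewrite setTI.
Qed.

Lemma PsiE r : normal_prob (0 : R) 1 [set z | r < z] = (Psi r)%:E.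
Proof.
rewrite /Psi fineK//; apply: fin_num_measure; exact: measurable_gt.
Qed.

Lemma Psi_ge0 r : 0 <= Psi r.
Proof. by rewrite /Psi fine_ge0. Qed.

Lemma Psi_le1 r : Psi r <= 1.
Proof. by rewrite -lee_fin -PsiE; apply: probability_le1; exact: measurable_gt. Qed.

Lemma nonincreasing_Psi : {homo @Psi R : x y / y <= x >-> x <= y}.
Proof.
move=> x y yx; rewrite -lee_fin -!PsiE; apply: le_measure; rewrite ?inE//.
- exact: measurable_gt.
- exact: measurable_gt.
- by move=> z /=; exact: le_lt_trans.
Qed.

Lemma measurable_Psi : measurable_fun setT (@Psi R).
Proof.
by apply: nonincreasing_measurable => // x y xy; exact: nonincreasing_Psi.
Qed.

Lemma heat_scale h x : 0 < h -> Num.sqrt h * heat h (Num.sqrt h * x) = heat 1 x.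
Proof.
move=> h0; have sh : Num.sqrt h != 0 by rewrite sqrtr_eq0 -ltNge.
rewrite !heatE// exprMn sqr_sqrtr ?ltW// mulrA; congr (_ * expR (- _)).
  rewrite mul1r -mulrnAr sqrtrM ?ltW//.
  by rewrite invfM mulrA divff ?mul1r.
by field; rewrite gt_eqF.
Qed.

(** Substitution y = sqrt h * x + al. *)
Lemma integral_heat_scale h (al : R) (F : R -> R) : 0 < h ->
  measurable_fun setT F -> (forall y, 0 <= F y) ->
  (\int[mu]_(y in D) (heat h (y - al) * F y)%:E =
   \int[mu]_(x in [set x : R | (- al / Num.sqrt h < x)%R])
     (heat 1 x * F (Num.sqrt h * x + al))%:E)%E.
Proof.
move=> h0 mF F0; have sh : 0 < Num.sqrt h by rewrite sqrtr_gt0.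
pose g y := (heat h (y - al) * F y)%:E.
have mg : measurable_fun setT (g \_ D).
  apply/(measurable_restrictT _ _).1 => //; apply: measurable_funTS.
  apply/measurable_EFinP/measurable_funM => //.
  by apply: measurable_heat_comp; exact: measurable_funB.
have g0 y : (0 <= (g \_ D) y)%E.
  by rewrite patchE; case: ifPn => // _; rewrite lee_fin mulr_ge0 ?heat_ge0.
have maff : measurable_fun setT (fun x : R => Num.sqrt h * x + al).
  by apply: measurable_funD => //; exact: measurable_funM.
rewrite [LHS]integral_mkcond -(ge0_integral_affine al sh mg g0).
rewrite -ge0_integralZl//=; last exact: (measurableT_comp mg maff).
transitivity (\int[mu]_(x in `[(- al / Num.sqrt h)%R, +oo[)
     (heat 1 x * F (Num.sqrt h * x + al))%:E)%E.
  rewrite [RHS]integral_mkcond; apply: eq_integral => x _.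
  rewrite !patchE; have -> : (Num.sqrt h * x + al \in D) =
      (x \in [set` `[- al / Num.sqrt h, +oo[]).
    apply/idP/idP; rewrite !inE/= !in_itv/= !andbT ler_pdivrMr//; lra.
  case: ifPn => _; last by rewrite mule0.
  by rewrite /g addrK -EFinM mulrA heat_scale.
rewrite -integral_itv_obnd_cbnd; last first.
  apply/measurable_EFinP/measurable_funTS/measurable_funM.
    exact: measurable_heat.
  exact: (measurableT_comp mF maff).
by congr (integral _ _ _); apply/seteqP; split => x /=; rewrite in_itv/= andbT.
Qed.

Lemma half_line_heat h al : 0 < h ->
  (\int[mu]_(y in D) (heat h (y - al))%:E = (Psi (- al / Num.sqrt h))%:E)%E.
Proof.
move=> h0; under eq_integral do rewrite -[heat _ _]mulr1.
rewrite (integral_heat_scale al (F := cst 1))// -PsiE /normal_prob.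
by apply: eq_integral => x _; rewrite mulr1 /heat sqrtr1.
Qed.

(** Given the first coordinate x, the second one is normal with mean rho * x and
    variance 1 - rho ^ 2. *)
Lemma Psi2E rho s t : rho ^+ 2 < 1 ->
  (Psi2 rho s t)%:E = (\int[mu]_(x in [set x : R | (s < x)%R])
    (heat 1 x * Psi ((t - rho * x) / Num.sqrt (1 - rho ^+ 2)))%:E)%E.
Proof.
move=> rho1; have q0 : 0 < Num.sqrt (1 - rho ^+ 2) by rewrite sqrtr_gt0 subr_gt0.
pose A : set (R * R) := [set z | s < z.1 /\
  t < rho * z.1 + Num.sqrt (1 - rho ^+ 2) * z.2].
have mA : measurable A.
  have mf : measurable_fun setT (fun z : R * R =>
      rho * z.1 + Num.sqrt (1 - rho ^+ 2) * z.2).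
    by apply: measurable_funD; exact: measurable_funM.
  exact: measurableI (measurable_gt_fun s measurable_fst) (measurable_gt_fun t mf).
have -> : Psi2 rho s t = fine ((normal_prob (0 : R) 1 \x normal_prob (0 : R) 1)%E A).
  rewrite /Psi2 /bivariate_normal /pushforward; congr (fine (_ _)).
  by apply/seteqP; split => z /=; rewrite !mxE/= mul1r mul0r addr0.
pose F := (fun x => (Psi ((t - rho * x) / Num.sqrt (1 - rho ^+ 2)))%:E)
  \_ [set x | s < x].
have -> : ((normal_prob (0 : R) 1 \x normal_prob (0 : R) 1) A =
    \int[normal_prob (0 : R) 1]_x F x)%E.
  apply: eq_integral => x _ /=; rewrite /F patchE.
  case: ifPn => [/set_mem/= sx|/negP sx].
    rewrite -PsiE; congr (normal_prob _ _ _); apply/seteqP; split => z.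
      by rewrite /xsection/= inE => -[_] /=; rewrite ltr_pdivrMr// mulrC; lra.
    by rewrite /xsection/= inE/= ltr_pdivrMr// mulrC => ?; split => //=; lra.
  rewrite (_ : xsection _ _ = set0) ?measure0//.
  apply/seteqP; split => z //; rewrite /xsection/= inE/= => -[sx' _].
  by apply: sx; rewrite inE.
have mF : measurable_fun setT F.
  apply/(measurable_restrictT _ _).1; first exact: measurable_gt.
  apply/measurable_EFinP/measurable_funTS; apply: (measurableT_comp measurable_Psi).
  by apply: measurable_funM => //; exact: measurable_funB.
have F0 x : (0 <= F x)%E.
  by rewrite /F patchE; case: ifPn => // _; rewrite lee_fin Psi_ge0.
have fin : (\int[normal_prob (0 : R) 1]_x F x)%E \is a fin_num.
  rewrite ge0_fin_numE; last by apply: integral_ge0 => x _.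
  apply: (@le_lt_trans _ _ (\int[normal_prob (0 : R) 1]_x (cst 1%E x))%E).
    apply: ge0_le_integral; [exact: measurableT|by move=> x _; exact: F0|
      exact: mF|exact: measurable_cst|move=> x _].
    by rewrite /F patchE; case: ifPn => // _; rewrite lee_fin ?Psi_le1.
  rewrite integral_cst// mul1e; apply: (@le_lt_trans _ _ 1%E); last exact: ltry.
  exact: (probability_le1 (normal_prob (0 : R) 1) measurableT).
apply: (etrans (fineK fin)).
rewrite (ge0_integral_density (mu := mu) (p := normal_pdf 0 1))//; last 2 first.
- exact: measurable_normal_pdf.
- by move=> x; exact: normal_pdf_ge0.
rewrite [RHS]integral_mkcond; apply: eq_integral => x _.
rewrite /F !patchE; case: ifPn => _; last by rewrite mul0e.
by rewrite -EFinM mulrC /heat sqrtr1.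
Qed.

(** With Z1 and Z2 independent standard normal variables, put
    Y = al + sqrt h * Z1.  The integral is the probability that Y >= 0 and
    sg * Y + be + sqrt s * Z2 >= 0.  The Gaussian variables sqrt h * Z1 and
    sg * sqrt h * Z1 + sqrt s * Z2 have variances h and h + s, and correlation
    sg * sqrt (h / (h + s)). *)
Lemma quadrant_heat (sg : R) h s al be : sg ^+ 2 = 1 -> 0 < h -> 0 < s ->
  (\int[mu]_(y in D)
     (heat h (y - al) * Psi (- (sg * y + be) / Num.sqrt s))%:E =
   (Psi2 (sg * Num.sqrt (h / (h + s))) (- al / Num.sqrt h)
      (- (be + sg * al) / Num.sqrt (h + s)))%:E)%E.
Proof.
move=> sg1 h0 s0; have hs0 : 0 < h + s by rewrite addr_gt0.
rewrite integral_heat_scale//; last 2 first.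
- apply: (measurableT_comp measurable_Psi); apply: measurable_funM => //.
  apply: measurableT_comp => //; apply: measurable_funD => //.
- by move=> y; exact: Psi_ge0.
have r2 : (sg * Num.sqrt (h / (h + s))) ^+ 2 = h / (h + s).
  by rewrite exprMn sg1 mul1r sqr_sqrtr// divr_ge0// ltW.
have r1 : 1 - (sg * Num.sqrt (h / (h + s))) ^+ 2 = s / (h + s).
  by rewrite r2; field; rewrite gt_eqF.
rewrite Psi2E; last by rewrite -subr_gt0 r1 divr_gt0.
apply: eq_integral => x _; congr ((_ * Psi _)%:E).
rewrite r1 !sqrtrM ?ltW// !sqrtrV ?ltW//.
by field; rewrite !gt_eqF// sqrtr_gt0.
Qed.

End normal_tails.

(** * Values of the killed operators *)

Section integral_value.
Context {R : realType}.
Local Notation mu := (@lebesgue_measure R).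
Local Notation D := (`[0%R, +oo[%classic : set R).

Implicit Types (f g : R -> R) (v w k : R).

(** Integrability is kept with the value of the integral, so that linear
    combinations with negative coefficients can be integrated. *)
Definition has_half_integral (f : R -> R) (v : R) : Prop :=
  mu.-integrable D (EFin \o f) /\ (\int[mu]_(y in D) (f y)%:E = v%:E)%E.

Lemma ge0_has_half_integral f v : measurable_fun setT f -> (forall y, 0 <= f y) ->
  (\int[mu]_(y in D) (f y)%:E = v%:E)%E -> has_half_integral f v.
Proof.
move=> mf f0 fv; split => //; apply/integrableP; split.
  exact/measurable_EFinP/measurable_funTS.
by under eq_integral do rewrite /= ger0_norm//; rewrite fv ltry.
Qed.

Lemma has_half_integralD f g v w : has_half_integral f v ->
  has_half_integral g w -> has_half_integral (fun y => f y + g y) (v + w).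
Proof.
move=> [fi fv] [gi gw]; split.
  rewrite (_ : _ \o _ = (EFin \o f) \+ (EFin \o g))%E; last exact/funext.
  exact: integrableD.
by rewrite integralD_EFin//= fv gw.
Qed.

Lemma has_half_integralZ f v k : has_half_integral f v ->
  has_half_integral (fun y => k * f y) (k * v).
Proof.
move=> [fi fv]; split.
  rewrite (_ : _ \o _ = fun y => (k%:E * (EFin \o f) y)%E); last exact/funext.
  exact: integrableZl.
under eq_integral do rewrite EFinM.
by rewrite integralZl//= fv.
Qed.

Lemma has_half_integral_eq f g v : has_half_integral f v ->
  (forall y, 0 <= y -> f y = g y) -> (\int[mu]_(y in D) (g y)%:E = v%:E)%E.
Proof.
move=> [_ <-] fg; apply: eq_integral => y /set_mem/=.
by rewrite in_itv/= andbT => /fg ->.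
Qed.

(** The function F below is even and has integral 2 over the line. *)
Lemma PsiN (x : R) : Psi (- x) = 1 - Psi x.
Proof.
pose F y := heat 1 (y - x) + heat 1 (y + x).
have F0 y : 0 <= F y by rewrite addr_ge0 ?heat_ge0.
have ch := @continuous_heat R 1 ltr01.
have cF : continuous F.
  move=> y; apply: cvgD.
  - apply: (cvg_comp (fun y => y - x) (heat 1)); last exact: ch.
    by apply: (@cvgB _ R^o); [exact: cvg_id|exact: cvg_cst].
  - apply: (cvg_comp (fun y => y + x) (heat 1)); last exact: ch.
    by apply: (@cvgD _ R^o); [exact: cvg_id|exact: cvg_cst].
have Fsym : F =1 F \o -%R.
  move=> y; rewrite /F/= addrC; congr (_ + _).
  - by rewrite -heatN//; congr heat; ring.
  - by rewrite -heatN//; congr heat; ring.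
have mh (al : R) : measurable_fun setT (fun y : R => heat 1 (y - al)).
  by apply: measurable_heat_comp; exact: measurable_funB.
have H (al : R) : has_half_integral (fun y => heat 1 (y - al)) (Psi (- al)).
  apply: ge0_has_half_integral => //; first by move=> y; exact: heat_ge0.
  by rewrite half_line_heat// sqrtr1 divr1.
have [_ HD] := has_half_integralD (H x) (H (- x)).
have FE y : F y = heat 1 (y - x) + heat 1 (y - - x) by rewrite /F opprK.
have FT : (\int[mu]_y (F y)%:E = 2%:E)%E.
  under eq_integral do rewrite FE EFinD.
  rewrite ge0_integralD//=.
  - by rewrite !integral_heat// -EFinD.
  - by move=> y _; rewrite lee_fin heat_ge0.
  - by apply/measurable_EFinP; exact: mh.
  - by move=> y _; rewrite lee_fin heat_ge0.
  - by apply/measurable_EFinP; exact: mh.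
have := ge0_symfun_integralT F0 cF Fsym.
rewrite FT -set_itvcy; under [in RHS]eq_integral do rewrite FE.
rewrite HD opprK -EFinM => -[]; lra.
Qed.

Lemma killed_images (c h y z : R) : 0 < h ->
  killed c h y z =
  heat h (z - (y + c * h)) - expR (- 2 * c * y) * heat h (z - (c * h - y)).
Proof.
move=> h0; rewrite killedE//.
have -> : z - (y + c * h) = (z - y) - c * h by ring.
have -> : z - (c * h - y) = (z + y) - c * h by ring.
rewrite !heat_drift// mulrBr mulrA -expRD; congr (_ - expR _ * _); ring.
Qed.

(** An exponential factor shifts the mean of a Gaussian density. *)
Lemma heat_tilt (c h al y : R) : 0 < h ->
  expR (- 2 * c * y) * heat h (y - al) =
  expR (2 * c ^+ 2 * h - 2 * c * al) * heat h (y - (al - 2 * c * h)).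
Proof.
move=> h0; have -> : y - al = (y - al + 2 * c * h) - (2 * c) * h by ring.
rewrite heat_drift// mulrA -expRD.
have -> : y - (al - 2 * c * h) = y - al + 2 * c * h by ring.
by congr (expR _ * _); field.
Qed.

Lemma kop_killed_one (c h y : R) : 0 < h ->
  kop (killed c h) (cst 1%E) y =
  (Psi (- (y + c * h) / Num.sqrt h) -
   expR (- 2 * c * y) * Psi (- (- y + c * h) / Num.sqrt h))%:E.
Proof.
move=> h0.
have H al : has_half_integral (fun z => heat h (z - al)) (Psi (- al / Num.sqrt h)).
  apply: ge0_has_half_integral; [|by move=> z; exact: heat_ge0|exact: half_line_heat].
  by apply: measurable_heat_comp; exact: measurable_funB.
have S := has_half_integralD (H (y + c * h))
  (has_half_integralZ (- expR (- 2 * c * y)) (H (c * h - y))).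
transitivity (\int[mu]_(z in D) (killed c h y z)%:E)%E.
  by apply: eq_integral => z _; rewrite mule1.
rewrite (has_half_integral_eq S); last first.
  by move=> z _; rewrite killed_images//; ring.
by rewrite (addrC (c * h)) !mulNr.
Qed.

(** Both kernels are differences of two images, so the product has four terms.
    The coefficient exp (- 2 c' y) of the image in the second kernel is absorbed
    by [heat_tilt] in the density of the position at time u. *)
Lemma kop_killed_two (c c' u s a : R) : 0 < u -> 0 < s -> 
  let Q sg al := Psi2 (sg * Num.sqrt (u / (u + s))) (- al / Num.sqrt u)
     (- (c' * s + sg * al) / Num.sqrt (u + s)) in
  kop (killed c u) (kop (killed c' s) (cst 1%E)) a =
  (Q 1 (a + c * u)
   - expR (- 2 * c * a) * Q 1 (c * u - a)
   - expR (2 * c' ^+ 2 * u - 2 * c' * (a + c * u)) *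
       Q (-1) (a + c * u - 2 * c' * u)
   + expR (- 2 * c * a) * expR (2 * c' ^+ 2 * u - 2 * c' * (c * u - a)) *
       Q (-1) (c * u - a - 2 * c' * u))%:E.
Proof.
move=> u0 s0 Q.
pose T sg al y := heat u (y - al) * Psi (- (sg * y + c' * s) / Num.sqrt s).
have HT sg al : sg ^+ 2 = 1 -> has_half_integral (T sg al) (Q sg al).
  move=> sg1; apply: ge0_has_half_integral.
  - apply: measurable_funM.
      by apply: measurable_heat_comp; exact: measurable_funB.
    apply: (measurableT_comp measurable_Psi); apply: measurable_funM => //.
    by apply: measurableT_comp => //; apply: measurable_funD => //.
  - by move=> y; rewrite mulr_ge0 ?heat_ge0 ?Psi_ge0.
  - exact: quadrant_heat.
have p1 : (1 : R) ^+ 2 = 1 by rewrite expr1n.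
have m1 : (-1 : R) ^+ 2 = 1 by rewrite sqrrN expr1n.
have S := has_half_integralD (has_half_integralD (has_half_integralD
  (HT _ (a + c * u) p1)
  (has_half_integralZ (- expR (- 2 * c * a)) (HT _ (c * u - a) p1)))
  (has_half_integralZ (- expR (2 * c' ^+ 2 * u - 2 * c' * (a + c * u)))
    (HT _ (a + c * u - 2 * c' * u) m1)))
  (has_half_integralZ
    (expR (- 2 * c * a) * expR (2 * c' ^+ 2 * u - 2 * c' * (c * u - a)))
    (HT _ (c * u - a - 2 * c' * u) m1)).
transitivity (\int[mu]_(y in D) (killed c u a y *
  (Psi (- (y + c' * s) / Num.sqrt s) -
   expR (- 2 * c' * y) * Psi (- (- y + c' * s) / Num.sqrt s)))%:E)%E.
  by apply: eq_integral => y _; rewrite kop_killed_one// -EFinM.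
rewrite (has_half_integral_eq S); first by rewrite !mulNr.
move=> y _; rewrite /T mul1r mulN1r killed_images//.
have e1 := heat_tilt c' (a + c * u) y u0.
have e2 := heat_tilt c' (c * u - a) y u0.
set X := expR (- 2 * c' * y) in e1 e2 *; set E1 := expR (- 2 * c * a).
set E2 := expR _ in e1 *; set E3 := expR _ in e2 *.
set hA := heat u (y - (a + c * u)) in e1 *.
set hB := heat u (y - (a + c * u - 2 * c' * u)) in e1 *.
set hC := heat u (y - (c * u - a)) in e2 *.
set hD := heat u (y - (c * u - a - 2 * c' * u)) in e2 *.
set P1 := Psi (- (y + _) / _); set P2 := Psi _.
transitivity (hA * P1 - E1 * hC * P1 - (E2 * hB) * P2 + E1 * (E3 * hD) * P2).
  by ring.
by rewrite -e1 -e2; ring.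
Qed.

End integral_value.

(** * Crossing two lines *)

Section crossing.
Context d (Omega : measurableType d) (R : realType) (P : probability Omega R).
Variables (B : R -> {RV P >-> R}).
Implicit Types a c T u s : R.

Definition below_line T a c : set Omega :=
  [set w | forall t, 0 <= t <= T -> B t w <= a + c * t].

Lemma below_lineE T a c w :
  below_line T a c w <-> ~ (a%:E < sup_drift B T c w)%E.
Proof.
split=> [wB|/negP].
  apply/negP; rewrite -leNgt; apply: ge_ereal_sup => _ [t /= tT <-].
  by rewrite lee_fin lerBlDr; apply: wB; rewrite in_itv in tT.
rewrite -leNgt => supa t tT; rewrite -lerBlDr -lee_fin.
apply: le_trans supa; apply: ereal_sup_ubound; exists t => //; rewrite /= in_itv.
Qed.

Lemma below_line_stays u s a c : 0 <= u -> 0 <= s ->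
  below_line (u + s) a c = stays_below B a c c u s.
Proof.
move=> u0 s0; apply/seteqP; split => w.
  move=> wB; split => t /andP[t0 tu].
    by apply: wB; rewrite t0 (le_trans tu)// lerDl.
  rewrite -addrA -mulrDr; apply: wB.
  by rewrite addr_ge0//= lerD2l.
move=> [w1 w2] t /andP[t0 tus]; have [tu|ut] := leP t u.
  by apply: w1; rewrite t0.
have -> : a + c * t = a + c * u + c * (t - u) by ring.
rewrite -[in B t](subrKC u t); apply: w2.
by rewrite subr_ge0 (ltW ut) lerBlDl.
Qed.

(** The first line is the lower one before time u, and the second one after. *)
Lemma below_two_lines u s a1 a2 c1 c2 : 0 <= u -> 0 <= s -> c2 <= c1 ->
  a1 + c1 * u = a2 + c2 * u ->
  below_line (u + s) a1 c1 `&` below_line (u + s) a2 c2 =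
  stays_below B a1 c1 c2 u s.
Proof.
move=> u0 s0 c21 meet; rewrite !below_line_stays//; apply/seteqP; split => w.
  move=> [[w1 _] [_ w2]]; split => t tr; first exact: w1.
  by rewrite meet; apply: w2.
move=> [w1 w2]; split; split => t /andP[t0 tr].
- by apply: w1; rewrite t0.
- apply: (le_trans (w2 t _)); first by rewrite t0.
  by rewrite lerD2l ler_wpM2r.
- apply: (le_trans (w1 t _)); first by rewrite t0.
  have -> : a2 = a1 + (c1 - c2) * u by lra.
  have : 0 <= (c1 - c2) * (u - t) by rewrite mulr_ge0// subr_ge0.
  nra.
- by rewrite -meet; apply: w2; rewrite t0.
Qed.

End crossing.

Theorem theorem2p2 (d : measure_display) (Omega : measurableType d)
    (R : realType) (P : probability Omega R) (B : R -> {RV P >-> R})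
    (hB : standard_brownian_motion P B)
    (T c1 c2 a1 a2 : R) (hT : 0 < T) (hc : c2 < c1)
    (ha1 : 0 < a1) (ha2 : a1 < a2) :
  let ts := (a2 - a1) / (c1 - c2) in
  ts < T ->
  joint_crossing_prob P B T c1 c2 a1 a2 =
  (Psi ((a1 + c1 * T) / Num.sqrt T)
   - Psi2 (- Num.sqrt (ts / T)) ((a1 + c1 * ts) / Num.sqrt ts)
       (- ((a2 + c2 * T) / Num.sqrt T))
   + expR (- 2 * a1 * c1) *
     (Psi ((a1 - c1 * T) / Num.sqrt T)
      - Psi2 (Num.sqrt (ts / T)) ((a1 - c1 * ts) / Num.sqrt ts)
          ((2 * a1 - a2 - c2 * T) / Num.sqrt T))
   + expR (- 2 * a2 * c2) *
     Psi2 (Num.sqrt (ts / T)) ((a2 - c2 * ts) / Num.sqrt ts)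
       ((a2 - c2 * T) / Num.sqrt T)
   + expR (- 2 * (a1 * (c1 - 2 * c2) + a2 * c2)) *
     Psi2 (- Num.sqrt (ts / T)) ((2 * a1 - a2 + c2 * ts) / Num.sqrt ts)
       ((a2 - 2 * a1 - c2 * T) / Num.sqrt T))%:E.
Proof.
move=> u uT.
have u0 : 0 < u by rewrite divr_gt0// subr_gt0.
have s0 : 0 < T - u by rewrite subr_gt0.
have TE : T = u + (T - u) by ring.
have a1_ge0 := ltW ha1; have a2_ge0 : 0 <= a2 by rewrite ltW// (lt_trans ha1).
have meet : a1 + c1 * u = a2 + c2 * u.
  by rewrite /u; field; rewrite subr_eq0 gt_eqF.
clearbody u.
pose N1 := below_line B T a1 c1; pose N2 := below_line B T a2 c2.
have N1E : N1 = stays_below B a1 c1 c1 u (T - u).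
  by rewrite /N1 {1}TE below_line_stays// ltW.
have N2E : N2 = stays_below B a2 c2 c2 u (T - u).
  by rewrite /N2 {1}TE below_line_stays// ltW.
have N12E : N1 `&` N2 = stays_below B a1 c1 c2 u (T - u).
  by rewrite /N1 /N2 {1 2}TE below_two_lines// ltW.
have mN1 : measurable N1 by rewrite N1E; exact: measurable_stays_below.
have mN2 : measurable N2 by rewrite N2E; exact: measurable_stays_below.
have -> : joint_crossing_prob P B T c1 c2 a1 a2 = P (~` (N1 `|` N2)).
  congr (P _); apply/seteqP; split => w /=.
    by move=> [w1 w2] [/below_lineE|/below_lineE].
  move=> /not_orP[/below_lineE w1 /below_lineE w2]; split; exact: contrapT.
rewrite probability_setC; last exact: measurableU.
have PU : P (N1 `|` N2) = (P N1 + P N2 - P (N1 `&` N2))%E.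
  apply: measureUfinr => //; rewrite (le_lt_trans (probability_le1 P mN2))//.
  exact: ltry.
have one : ge0_fun (cst 1%E : R -> \bar R) by split.
pose Q sg al := Psi2 (sg * Num.sqrt (u / T)) (- al / Num.sqrt u)
  (- (c2 * (T - u) + sg * al) / Num.sqrt T).
(* The value of [kop_killed_two] for the slopes c and c2. *)
pose V a c := Q 1 (a + c * u)
   - expR (- 2 * c * a) * Q 1 (c * u - a)
   - expR (2 * c2 ^+ 2 * u - 2 * c2 * (a + c * u)) *
       Q (-1) (a + c * u - 2 * c2 * u)
   + expR (- 2 * c * a) * expR (2 * c2 ^+ 2 * u - 2 * c2 * (c * u - a)) *
       Q (-1) (c * u - a - 2 * c2 * u).
have VE a c : 0 <= a -> P (stays_below B a c c2 u (T - u)) = (V a c)%:E.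
  move=> a0; rewrite prob_stays_below//.
  by have := kop_killed_two c c2 a u0 s0; rewrite -TE.
have PN1 : P N1 = (1 - Psi ((a1 + c1 * T) / Num.sqrt T) -
    expR (- 2 * c1 * a1) * Psi ((a1 - c1 * T) / Num.sqrt T))%:E.
  rewrite N1E prob_stays_below// (kop_killed_comp c1 u0 s0 one a1_ge0) -TE.
  rewrite -PsiN -[- ((a1 + _) / _)]mulNr.
  have -> : a1 - c1 * T = - (- a1 + c1 * T) by ring.
  exact: kop_killed_one.
rewrite PU PN1 N12E N2E !VE//; congr (_%:E).
(* This identifies the first and the third terms of V a1 c1 with those of
   V a2 c2. *)
rewrite /V meet.
have Psi2_congr r x x' y y' z z' : x = x' -> y = y' ->
    Psi2 r (x / z) (y / z') = Psi2 r (x' / z) (y' / z') :> R by move=> -> ->.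
have a2E : a2 = a1 + c1 * u - c2 * u by rewrite meet addrK.
have q1 : Q (-1) (c2 * u - a2 - 2 * c2 * u) =
    Psi2 (- Num.sqrt (u / T)) ((a2 + c2 * u) / Num.sqrt u)
      (- ((a2 + c2 * T) / Num.sqrt T)).
  rewrite /Q mulN1r -[- ((a2 + _) / _)]mulNr; apply: Psi2_congr; ring.
have q2 : Q 1 (c1 * u - a1) = Psi2 (Num.sqrt (u / T)) ((a1 - c1 * u) / Num.sqrt u)
      ((2 * a1 - a2 - c2 * T) / Num.sqrt T).
  by rewrite /Q mul1r; apply: Psi2_congr; rewrite ?a2E; ring.
have q3 : Q 1 (c2 * u - a2) = Psi2 (Num.sqrt (u / T)) ((a2 - c2 * u) / Num.sqrt u)
      ((a2 - c2 * T) / Num.sqrt T).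
  by rewrite /Q mul1r; apply: Psi2_congr; ring.
have q4 : Q (-1) (c1 * u - a1 - 2 * c2 * u) =
    Psi2 (- Num.sqrt (u / T)) ((2 * a1 - a2 + c2 * u) / Num.sqrt u)
      ((a2 - 2 * a1 - c2 * T) / Num.sqrt T).
  by rewrite /Q mulN1r; apply: Psi2_congr; rewrite ?a2E; ring.
rewrite q1 q2 q3 q4 -!expRD.
(* The coefficient of the fourth term of V a2 c2 is 1. *)
have -> : - 2 * c2 * a2 + (2 * c2 ^+ 2 * u - 2 * c2 * (c2 * u - a2)) = 0 by ring.
have -> : - 2 * c1 * a1 + (2 * c2 ^+ 2 * u - 2 * c2 * (c1 * u - a1)) =
    - 2 * (a1 * (c1 - 2 * c2) + a2 * c2).
  by rewrite a2E; ring.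
rewrite expR0.
have -> : - 2 * c1 * a1 = - 2 * a1 * c1 by ring.
have -> : - 2 * c2 * a2 = - 2 * a2 * c2 by ring.
move: (Q 1 _) (Q (-1) _) (Psi2 _ _ _) (Psi2 _ _ _) (Psi2 _ _ _) (Psi2 _ _ _).
move: (Psi _) (Psi _) (expR _) (expR _) (expR _) (expR _).
by move=> *; ring.
Qed.
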